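(* Let $I$ be an ideal of a commutative Noetherian ring $R$ with non-zero identity. Let $M$ be an $\mathrm{FD}_{\leq 1}$ $I$-cofinite $R$-module. Then the $R$-modules $\operatorname{Ext}^i_R(N,M)$ and $\operatorname{Tor}^R_i(N,M)$ are $I$-cofinite and $\mathrm{FD}_{\leq 1}$ modules, for all finitely generated $R$-modules $N$ and all integers $i\geq 0$.
   Context: $V(I)=\{\mathfrak p\in\operatorname{Spec} R : \mathfrak p\supseteq I\}$. For a (not necessarily finitely generated) $R$-module $T$, $\dim T$ is the supremum of $\dim R/\mathfrak p$ over $\mathfrak p\in\operatorname{Supp} T$ (with $\dim 0=-1$). An $R$-module $L$ is called $\mathrm{FD}_{\leq 1}$ if there is a finitely generated submodule $L'$ of $L$ with $\dim (L/L')\leq 1$. An $R$-module $L$ is $I$-cofinite if $\operatorname{Supp}(L)\subseteq V(I)$ and $\operatorname{Ext}^i_R(R/I,L)$ is finitely generated for all $i\geq 0$. *)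

(* Defs.v *)
From HB Require Import structures.
From mathcomp Require Import all_boot all_order all_algebra.
From mathcomp Require Import boolp classical_sets constructive_ereal.
From mathcomp Require Import freeg ring zify.

Set Implicit Arguments.
Unset Strict Implicit.
Unset Printing Implicit Defensive.

Import Order.TTheory GRing.Theory Num.Theory.
Local Open Scope ring_scope.
Local Open Scope quotient_scope.

(* Submodules are [submodClosed V], i.e. boolean predicates closed under the
   module operations; with the excluded middle of boolp ([`[< P >] : bool])
   these are all the submodules.  An ideal of R (possibly R itself) is a
   submodule of R^o; mathcomp's [idealr] only covers proper ideals and is used
   only for primes ([prime_idealr]). *)

Section Submodule.
Variables (R : comNzRingType) (V : lmodType R) (W : submodClosed V).

Record submod := Submod { submod_val : V; _ : submod_val \in W }.

HB.instance Definition _ := [isSub for submod_val].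
HB.instance Definition _ := [Choice of submod by <:].
HB.instance Definition _ := [SubChoice_isSubLmodule of submod by <:].

Definition submod_incl : {linear submod -> V} := val.

End Submodule.

Section QuotientModule.
Variables (R : comNzRingType) (V : lmodType R) (W : submodClosed V).

(* mathcomp has no inheritance path from [submodClosed] to [zmodClosed]. *)
Definition submod_zmod : V -> bool := [in W].
HB.instance Definition _ := GRing.isZmodClosed.Build V submod_zmod
  (GRing.submod_closedB (submodClosedP W)).

Local Notation Q := 
  (@Quotient.quot V (GRing.ZmodClosed.clone V submod_zmod _)).

Definition quotmod : Type := Q.

HB.instance Definition _ := GRing.Zmodule.on quotmod.

Definition quot_pi : V -> quotmod := \pi_Q.

Lemma quot_pi_eq x y : (quot_pi x = quot_pi y) <-> (x - y \in W).
Proof.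
rewrite /quot_pi; split=> [/eqmodP|?]; last exact/eqmodP.
by rewrite /= Quotient.equivE.
Qed.

Lemma quot_piK (x : quotmod) : quot_pi (repr (x : Q)) = x.
Proof. exact: reprK. Qed.

Lemma quot_piB x y : quot_pi (x - y) = quot_pi x - quot_pi y.
Proof. exact: (pi_is_zmod_morphism Q). Qed.

Lemma quot_piD x y : quot_pi (x + y) = quot_pi x + quot_pi y.
Proof. exact: (@pi_addr _ _ _ _ _ Q). Qed.

Definition quot_scale (a : R) (x : quotmod) : quotmod :=
  quot_pi (a *: repr (x : Q)).

Lemma quot_scale_pi a x : quot_scale a (quot_pi x) = quot_pi (a *: x).
Proof.
by apply/quot_pi_eq; rewrite -scalerBr rpredZ //; apply/quot_pi_eq/quot_piK.
Qed.

Fact quot_scalerA a b x : quot_scale a (quot_scale b x) = quot_scale (a * b) x.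
Proof. by rewrite -[x]quot_piK !quot_scale_pi scalerA. Qed.

Fact quot_scale1r x : quot_scale 1 x = x.
Proof. by rewrite -[x]quot_piK quot_scale_pi scale1r. Qed.

Fact quot_scalerDr a x y :
  quot_scale a (x + y) = quot_scale a x + quot_scale a y.
Proof.
by rewrite -[x]quot_piK -[y]quot_piK -quot_piD !quot_scale_pi scalerDr quot_piD.
Qed.

Fact quot_scalerDl x a b :
  quot_scale (a + b) x = quot_scale a x + quot_scale b x.
Proof. by rewrite -[x]quot_piK !quot_scale_pi scalerDl quot_piD. Qed.

HB.instance Definition _ := GRing.Zmodule_isLmodule.Build R quotmod
  quot_scalerA quot_scale1r quot_scalerDr quot_scalerDl.

Fact quot_pi_linear : linear quot_pi.
Proof. by move=> a x y; rewrite quot_piD -quot_scale_pi. Qed.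

HB.instance Definition _ := GRing.isLinear.Build R V quotmod _ quot_pi
  quot_pi_linear.

End QuotientModule.

Section Predicates.
Variables (R : comNzRingType) (U V : lmodType R).

Section Ker.
Variable f : {linear U -> V}.
Definition ker_pred : U -> bool := [pred u | f u == 0].
Fact ker_submod_closed : submod_closed ker_pred.
Proof.
split=> [|a u v]; rewrite !inE ?linear0 // => /eqP fu /eqP fv.
by rewrite linearP fu fv scaler0 addr0.
Qed.
HB.instance Definition _ := GRing.isSubmodClosed.Build R U ker_pred
  ker_submod_closed.
Definition kernel : submodClosed U := GRing.SubmodClosed.clone R U ker_pred _.
End Ker.

Section Image.
Variable f : {linear U -> V}.
Definition im_pred : V -> bool := [pred v | `[< exists u, f u = v >]].
Fact im_submod_closed : submod_closed im_pred.
Proof.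
split=> [|a v w].
  by apply/asboolP; exists 0; rewrite linear0.
move=> /asboolP[x <-] /asboolP[y <-]; apply/asboolP.
by exists (a *: x + y); rewrite linearP.
Qed.
HB.instance Definition _ := GRing.isSubmodClosed.Build R V im_pred
  im_submod_closed.
Definition image_submod : submodClosed V := GRing.SubmodClosed.clone R V im_pred _.
End Image.

Section Preimage.
Variables (f : {linear U -> V}) (W : submodClosed V).
Definition preim_pred : U -> bool := [pred u | f u \in W].
Fact preim_submod_closed : submod_closed preim_pred.
Proof.
split=> [|a u v]; rewrite !inE ?linear0 ?rpred0 // => fu fv.
by rewrite linearP rpredD ?rpredZ.
Qed.
HB.instance Definition _ := GRing.isSubmodClosed.Build R U preim_pred
  preim_submod_closed.
Definition preim_submod : submodClosed U := GRing.SubmodClosed.clone R U preim_pred _.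
End Preimage.

Section Span.
Variable S : U -> Prop.
Definition span_pred : U -> bool :=
  [pred u | `[< forall W : submodClosed U, (forall x, S x -> x \in W) ->
                  u \in W >]].
Fact span_submod_closed : submod_closed span_pred.
Proof.
split=> [|a u v]; first by apply/asboolP=> W _; rewrite rpred0.
move=> /asboolP Su /asboolP Sv; apply/asboolP=> W SW.
by rewrite rpredD // ?rpredZ // (Su, Sv).
Qed.
HB.instance Definition _ := GRing.isSubmodClosed.Build R U span_pred
  span_submod_closed.
Definition span_submod : submodClosed U := GRing.SubmodClosed.clone R U span_pred _.
End Span.

End Predicates.

Definition fin_gen (R : comNzRingType) (V : lmodType R) : Prop :=
  exists s : seq V, forall v : V,
    exists c : 'I_(size s) -> R, v = \sum_(i < size s) c i *: s`_i.

Definition noetherian (R : comNzRingType) : Prop :=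
  forall J : submodClosed R^o, fin_gen (submod J).

(* T_p: fractions t/s with s outside p, where t/s = t'/s' when
   u (s' t - s t') = 0 for some u outside p.  Only the underlying set and its
   zero 0/1 are needed, to say T_p <> 0. *)
Section Localization.
Variables (R : comNzRingType) (p : prime_idealr R) (T : lmodType R).

Definition denom := {s : R | s \notin p}.

Definition frac_eq (x y : T * denom) : bool :=
  `[< exists2 u : R, u \notin p & u *: (val y.2 *: x.1 - val x.2 *: y.1) = 0 >].

Fact frac_eq_equiv : equiv_class_of frac_eq.
Proof.
split.
- by move=> x; apply/asboolP; exists 1; rewrite ?idealr1 // subrr scaler0.
- suff sub x y : frac_eq x y -> frac_eq y x by move=> x y; apply/idP/idP; apply: sub.
  move=> /asboolP[u pu e]; apply/asboolP; exists u => //.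
  by rewrite -opprB scalerN e oppr0.
move=> [y s] [x r] [z t] /asboolP[/= u pu e] /asboolP[/= v pv f].
apply/asboolP; exists (u * v * val s) => /=.
  by rewrite !prime_idealrM !negb_or pu pv (valP s).
move: e f; rewrite !scalerBr !scalerA => /eqP; rewrite subr_eq0 => /eqP e.
move=> /eqP; rewrite subr_eq0 => /eqP f.
apply/eqP; rewrite subr_eq0; apply/eqP.
have -> : u * v * val s * val t = v * val t * (u * val s) by ring.
have -> : u * v * val s * val r = u * val r * (v * val s) by ring.
by rewrite -scalerA e -[RHS]scalerA -f !scalerA; congr (_ *: _); rewrite mulrC.
Qed.

Canonical frac_eq_equiv_rel := EquivRelPack frac_eq_equiv.
Canonical frac_eq_encModRel := defaultEncModRel frac_eq.

Definition localization : Type := {eq_quot frac_eq}.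

Definition frac (t : T) (s : denom) : localization :=
  \pi_({eq_quot frac_eq}) (t, s).

Fact one_denom : 1 \notin p. Proof. by rewrite idealr1. Qed.

Definition loc0 : localization := frac 0 (exist _ 1 one_denom).

End Localization.

Section Dimension.
Local Open Scope classical_set_scope.

Definition supp (R : comNzRingType) (T : lmodType R) (p : prime_idealr R) :
    Prop :=
  exists x : localization p T, x <> loc0 p T.

Definition V_of (R : comNzRingType) (I : submodClosed R^o) (p : prime_idealr R) :
    Prop :=
  forall x : R, x \in I -> x \in p.

Definition prime_lt (A : comNzRingType) (p q : prime_idealr A) : Prop :=
  (forall x, x \in p -> x \in q) /\ (exists2 x, x \in q & x \notin p).

Definition prime_chain (A : comNzRingType) (n : nat) : Prop :=
  exists p : 'I_n.+1 -> prime_idealr A,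
    forall i j : 'I_n.+1, (i < j)%N -> prime_lt (p i) (p j).

(* The first argument of [supremum] is thus only used at the empty set. *)
Lemma supremums_ereal_int (A : set (\bar int)) : supremums A !=set0.
Proof.
have [An|/existsNP[a /not_implyP[Aa aN]]] := pselect (forall x, A x -> x = -oo%E).
  by exists -oo%E; split=> [x /An ->//|y _]; rewrite leNye.
have [[b ubb]|nob] := pselect (exists b : int, ubound A b%:E); last first.
  exists +oo%E; split=> [x _|[c||] ubc]; rewrite ?leey //.
  - by case: nob; exists c.
  - by case: aN; move: (ubc _ Aa); rewrite leeNy_eq => /eqP.
have [a' ea] : exists a' : int, a = a'%:E.
  by case: a Aa aN => [a' _ _|/ubb|] //; exists a'.
pose P n := `[< ubound A (b - n%:Z)%:E >].
have exP : exists n, P n by exists 0%N; apply/asboolP; rewrite subr0.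
have bdP n : P n -> (n <= `|b - a'|)%N.
  by move=> /asboolP/(_ _ Aa); rewrite ea lee_fin; lia.
case: (ex_maxnP exP bdP) => n /asboolP ubn maxn; exists (b - n%:Z)%:E.
split=> // -[c||] ubc; rewrite ?leey //; last first.
  by move: (ubc _ Aa); rewrite leeNy_eq => /eqP.
rewrite lee_fin leNgt; apply/negP => cn.
suff /maxn : P n.+1 by rewrite ltnn.
by apply/asboolP => x /ubc /le_trans; apply; rewrite lee_fin; lia.
Qed.

Definition krull_dim (A : comNzRingType) : \bar int :=
  supremum (-1)%:E [set d | exists2 n : nat, prime_chain A n & d = n%:Z%:E].

Definition mod_dim (R : comNzRingType) (T : lmodType R) : \bar int :=
  supremum (-1)%:E [set d | exists2 p, supp T p & d = krull_dim {ideal_quot p}].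

End Dimension.

Definition FD_le1 (R : comNzRingType) (L : lmodType R) : Prop :=
  exists L' : submodClosed L,
    fin_gen (submod L') /\ (mod_dim (quotmod L') <= 1%:E)%E.


Section Hom.
Variables (R : comNzRingType) (U V : lmodType R).

Definition Hom : Type := {linear U -> V}.
Implicit Types f g h : Hom.

HB.instance Definition _ := gen_eqMixin Hom.
HB.instance Definition _ := gen_choiceMixin Hom.

Lemma hom_ext (f g : {linear U -> V}) : f =1 g -> f = g :> Hom.
Proof.
case: f g => [f [[a] [b]]] [g [[a'] [b']]] /= /funext fg.
case: _ / fg a' b' => a' b'.
by rewrite (Prop_irrelevance a a') (Prop_irrelevance b b').
Qed.

Definition hom0 : Hom := \0.
Definition hom_add f g : Hom := f \+ g.
Definition hom_opp f : Hom := \- f.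
Definition hom_scale (a : R) f : Hom := a \*: f.

Fact hom_addA : associative hom_add.
Proof. by move=> f g h; apply: hom_ext => x /=; rewrite addrA. Qed.
Fact hom_addC : commutative hom_add.
Proof. by move=> f g; apply: hom_ext => x /=; rewrite addrC. Qed.
Fact hom_add0 : left_id hom0 hom_add.
Proof. by move=> f; apply: hom_ext => x /=; rewrite add0r. Qed.
Fact hom_addN : left_inverse hom0 hom_opp hom_add.
Proof. by move=> f; apply: hom_ext => x /=; rewrite addNr. Qed.

HB.instance Definition _ := GRing.isZmodule.Build Hom
  hom_addA hom_addC hom_add0 hom_addN.

Fact hom_scalerA a b f : hom_scale a (hom_scale b f) = hom_scale (a * b) f.
Proof. by apply: hom_ext => x /=; rewrite scalerA. Qed.
Fact hom_scale1r f : hom_scale 1 f = f.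
Proof. by apply: hom_ext => x /=; rewrite scale1r. Qed.
Fact hom_scalerDr a f g :
  hom_scale a (f + g) = hom_scale a f + hom_scale a g.
Proof. by apply: hom_ext => x /=; rewrite scalerDr. Qed.
Fact hom_scalerDl f a b : hom_scale (a + b) f = hom_scale a f + hom_scale b f.
Proof. by apply: hom_ext => x /=; rewrite scalerDl. Qed.

HB.instance Definition _ := GRing.Zmodule_isLmodule.Build R Hom
  hom_scalerA hom_scale1r hom_scalerDr hom_scalerDl.

End Hom.

Section Precomposition.
Variables (R : comNzRingType) (U V M : lmodType R) (f : {linear U -> V}).

Definition precomp (h : Hom V M) : Hom U M := (h : {linear V -> M}) \o f.

Fact precomp_linear : linear precomp.
Proof. by move=> a g h; apply: hom_ext. Qed.

HB.instance Definition _ := GRing.isLinear.Build R (Hom V M) (Hom U M) _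
  precomp precomp_linear.

End Precomposition.
Arguments precomp {R U V} M f h.

Section Free.
Variables (R : comNzRingType) (K : choiceType).

(* The free module R^(K). *)
Definition free_mod : Type := {freeg K / R}.
HB.instance Definition _ := GRing.Lmodule.on free_mod.

Definition free_gen (k : K) : free_mod := [freeg [:: (1, k)]].

Variables (V : lmodType R) (f : K -> V).

Definition free_lift : free_mod -> V := fglift f.

Lemma free_lift_gen k : free_lift (free_gen k) = f k.
Proof. by rewrite /free_lift liftU scale1r. Qed.

Fact free_lift_linear : linear free_lift.
Proof.
have addf : {morph free_lift : x y / x + y}.
  have B x y : free_lift (x - y) = free_lift x - free_lift y.
    exact: lift_is_additive.
  have B0 : free_lift 0 = 0 by rewrite -[0 in LHS](subrr 0) B subrr.
  have N z : free_lift (- z) = - free_lift z by rewrite -sub0r B B0 sub0r.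
  by move=> x y; rewrite -[y in LHS]opprK B N opprK.
have lift0 : free_lift 0 = 0 by apply/(addrI (free_lift 0)); rewrite -addf !addr0.
have addsum (r : seq K) (F : K -> free_mod) :
    free_lift (\sum_(k <- r) F k) = \sum_(k <- r) free_lift (F k).
  exact: (big_morph _ addf lift0).
move=> a x y; rewrite addf; congr (_ + _).
rewrite [a *: x]/(fgscale a x) addsum -[x in RHS]freeg_sumE addsum scaler_sumr.
by apply: eq_bigr => k _; rewrite /free_lift !liftU scalerA.
Qed.

HB.instance Definition _ := GRing.isLinear.Build R free_mod V _ free_lift
  free_lift_linear.

End Free.

(* U (x) M is the free module on U * M modulo the bilinearity relations. *)
Section Tensor.
Variables (R : comNzRingType) (M : lmodType R).

Local Notation "U *c M" := (Choice.clone (U * M)%type _)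
  (at level 40, only parsing).

Section Def.
Variable U : lmodType R.

Local Notation g := (@free_gen R (U *c M)).

Variant bilin_rel : free_mod R (U *c M) -> Prop :=
| BilinAddl u v m : bilin_rel (g (u + v, m) - (g (u, m) + g (v, m)))
| BilinAddr u m n : bilin_rel (g (u, m + n) - (g (u, m) + g (u, n)))
| BilinScalel a u m : bilin_rel (g (a *: u, m) - a *: g (u, m))
| BilinScaler a u m : bilin_rel (g (u, a *: m) - a *: g (u, m)).

Definition tensor_mod : Type := quotmod (span_submod bilin_rel).
HB.instance Definition _ := GRing.Lmodule.on tensor_mod.

Definition tensor (u : U) (m : M) : tensor_mod := quot_pi _ (g (u, m)).

Lemma tensorDl u v m : tensor (u + v) m = tensor u m + tensor v m.
Proof.
rewrite -quot_piD; apply/quot_pi_eq/asboolP => W; apply.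
exact: BilinAddl.
Qed.

Lemma tensorDr u m n : tensor u (m + n) = tensor u m + tensor u n.
Proof.
rewrite -quot_piD; apply/quot_pi_eq/asboolP => W; apply.
exact: BilinAddr.
Qed.

Lemma tensorZl a u m : tensor (a *: u) m = a *: tensor u m.
Proof.
rewrite [RHS]quot_scale_pi; apply/quot_pi_eq/asboolP => W; apply.
exact: BilinScalel.
Qed.

Lemma tensorZr a u m : tensor u (a *: m) = a *: tensor u m.
Proof.
rewrite [RHS]quot_scale_pi; apply/quot_pi_eq/asboolP => W; apply.
exact: BilinScaler.
Qed.

End Def.

Variables (U V : lmodType R) (f : {linear U -> V}).

Definition tensor_map_pre : free_mod R (U *c M) -> tensor_mod V :=
  free_lift (fun um => tensor (f um.1) um.2).
HB.instance Definition _ := GRing.Linear.on tensor_map_pre.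

(* f (x) id_M *)
Definition tensor_map (x : tensor_mod U) : tensor_mod V :=
  tensor_map_pre (repr (x : Quotient.quot _)).

Lemma tensor_map_pi x : tensor_map (quot_pi _ x) = tensor_map_pre x.
Proof.
apply/eqP; rewrite -subr_eq0 -linearB; apply/eqP.
have /quot_pi_eq/asboolP/(_ (kernel tensor_map_pre)) :=
  quot_piK (quot_pi (span_submod (@bilin_rel U)) x).
rewrite -[_ \in kernel _]/(_ == 0) => H; apply/eqP; apply: H => {}x [] *.
all: rewrite -[_ \in kernel _]/(_ == 0) linearB ?linearD ?linearZ /=.
all: rewrite /tensor_map_pre !free_lift_gen /=.
- by rewrite linearD tensorDl -opprD subrr.
- by rewrite tensorDr -opprD subrr.
- by rewrite linearZ tensorZl scalerN subrr.
- by rewrite tensorZr scalerN subrr.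
Qed.

Lemma tensor_mapE u m : tensor_map (tensor u m) = tensor (f u) m.
Proof. by rewrite tensor_map_pi [LHS]free_lift_gen. Qed.

Fact tensor_map_linear : linear tensor_map.
Proof.
move=> a x y; rewrite -[x]quot_piK -[y]quot_piK -linearP !tensor_map_pi.
exact: linearP.
Qed.

HB.instance Definition _ := GRing.isLinear.Build R (tensor_mod U)
  (tensor_mod V) _ tensor_map tensor_map_linear.

End Tensor.
Arguments tensor_map {R} M {U V} f x.

(* ker g / im f for U --f--> V --g--> W (with g \o f = 0). *)
Definition homology (R : comNzRingType) (U V W : lmodType R)
    (f : {linear U -> V}) (g : {linear V -> W}) : lmodType R :=
  quotmod (preim_submod (submod_incl (kernel g)) (image_submod f)).

Section Resolution.
Variables (R : comNzRingType) (N : lmodType R).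

Definition free_cover (V : lmodType R) : {linear free_mod R V -> V} :=
  free_lift id.

(* syz 0 = N and syz n.+1 is the kernel of R^(syz n) -> syz n. *)
Fixpoint syz (n : nat) : lmodType R :=
  if n is m.+1 then submod (kernel (free_cover (syz m))) else N.

(* The free resolution used to compute Ext and Tor (which do not depend on
   the projective resolution, up to isomorphism):
    ... -> res 1 -> res 0 -> N -> 0. *)
Definition res (n : nat) : lmodType R := free_mod R (syz n).

Definition res_d (n : nat) : {linear res n.+1 -> res n} :=
  submod_incl (kernel (free_cover (syz n))) \o free_cover (syz n.+1).

Lemma free_cover_surj (V : lmodType R) (v : V) : exists x, free_cover V x = v.
Proof. by exists (free_gen R v); rewrite /free_cover /= free_lift_gen. Qed.

Lemma res_d_exact n (x : res n.+1) :
  res_d n x = 0 <-> exists y, res_d n.+1 y = x.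
Proof.
split=> [x0|[y <-]].
  have kx : x \in kernel (free_cover (syz n.+1)).
    by apply/eqP/val_inj; rewrite linear0; exact: x0.
  have [y yx] := free_cover_surj (Submod kx : syz n.+2).
  by exists y; rewrite /res_d /= -/(free_cover _) yx.
rewrite /res_d /=; set z := free_lift _ y.
have /eqP z0 : submod_val z \in kernel (free_cover (syz n.+1)) := valP z.
exact: (congr1 (submod_incl _) z0).
Qed.

End Resolution.

Section ExtTor.
Variables (R : comNzRingType) (N M : lmodType R).

Definition Ext (i : nat) : lmodType R :=
  if i is j.+1 then homology (precomp M (res_d N j)) (precomp M (res_d N j.+1))
  else homology (\0 : {linear Hom (res N 0) M -> Hom (res N 0) M})
                (precomp M (res_d N 0)).

Definition Tor (i : nat) : lmodType R :=
  if i is j.+1 then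
    homology (tensor_map M (res_d N j.+1)) (tensor_map M (res_d N j))
  else homology (tensor_map M (res_d N 0))
         (\0 : {linear tensor_mod M (res N 0) -> tensor_mod M (res N 0)}).

End ExtTor.

Definition cofinite (R : comNzRingType) (I : submodClosed R^o)
    (L : lmodType R) : Prop :=
  (forall p, supp L p -> V_of I p) /\
  (forall i : nat, fin_gen (Ext (quotmod I) L i)).

(* Main.v *)
From HB Require Import structures.
From mathcomp Require Import all_boot all_order all_algebra.
From mathcomp Require Import boolp classical_sets constructive_ereal ring.
Require Import Defs.

(* Everything follows once the I-cofinite FD_{<=1} modules are known to be closed
   under extensions, kernels and cokernels: a finitely generated N has a resolution
   by finite free modules F_n, and Ext^i(N, M), Tor_i(N, M) are homology modules of
   complexes of the modules Hom(F_n, M) = M^(r_n), F_n (x) M = M^(r_n).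

   Closure under kernels and cokernels follows, through the long exact sequence of
   Ext(R/I, -), from the criterion: if Supp M is contained in V(I), dim M <= 1 and
   Ext^n(R/I, M) is finitely generated for n <= dim M, then M is I-cofinite.  The
   criterion is proved by induction on the dimension and on the number of elements
   of a finite generating set of I which do not annihilate M.  If there is none, then
   M = 0 :_M I is Hom(R/I, M), hence finitely generated.  Otherwise choose a
   generator z that does not annihilate M.  As 0 :_M I is finitely generated, M is
   Artinian up to modules of smaller dimension, so that for some w = z^k the module
   T = M / (w M + (0 :_M w)) has smaller dimension.  Since w M = M / (0 :_M w) embeds
   in M, the long exact sequences show that the hypotheses of the criterion pass to
   B = 0 :_M w, to B n w M (both killed by a power of z) and then to T.  Hence these
   modules are cofinite, and so is M / w M, an extension of T by B / (B n w M).
   Finally, w annihilates Ext(R/I, M), and the finiteness of Ext(R/I, 0 :_M w) and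
   Ext(R/I, M / w M) implies that of Ext(R/I, M). *)

Set Implicit Arguments.
Unset Strict Implicit.
Unset Printing Implicit Defensive.

Import Order.TTheory GRing.Theory Num.Theory.
Local Open Scope ring_scope.
Local Open Scope quotient_scope.

(** * Submodules and linear maps *)

Section PropSubmod.
Variables (R : comNzRingType) (V : lmodType R) (P : V -> Prop).
Hypothesis closedP : P 0 /\ forall a u v, P u -> P v -> P (a *: u + v).

(** The closure proof is an argument of the predicate so that the submodule structure can be
    attached to [prop_pred closedP] and submodules can be built on the spot from a proposition. *)
Definition prop_pred & (P 0 /\ forall a u v, P u -> P v -> P (a *: u + v)) :
  V -> bool := fun v => `[< P v >].

Fact prop_pred_closed : submod_closed (prop_pred closedP).
Proof.
split=> [|a u v]; first exact/asboolP/closedP.1.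
by move=> /asboolP Pu /asboolP Pv; apply/asboolP/closedP.2.
Qed.

HB.instance Definition _ := GRing.isSubmodClosed.Build R V (prop_pred closedP)
  prop_pred_closed.

Definition prop_submod : submodClosed V :=
  GRing.SubmodClosed.clone R V (prop_pred closedP) _.

Lemma mem_prop_submod v : (v \in prop_submod) <-> P v.
Proof. by split=> [/asboolP|?] //; apply/asboolP. Qed.

End PropSubmod.

Section Linear.
Variables (R : comNzRingType).
Implicit Types U V W K Q B C : lmodType R.

Lemma linear_exists U V (f : U -> V) :
  linear f -> exists g : {linear U -> V}, forall x, g x = f x.
Proof.
move=> lf; pose F := GRing.isLinear.Build R U V *:%R f lf.
by exists (HB.pack_for {linear U -> V} f F).
Qed.

Definition surj (A B : Type) (f : A -> B) := forall y, exists x, f x = y.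

Lemma lin_injP U V (f : {linear U -> V}) :
  (forall x, f x = 0 -> x = 0) <-> injective f.
Proof.
split=> [f0 x y fxy|fi x fx].
  by apply/eqP; rewrite -subr_eq0; apply/eqP/f0; rewrite linearB fxy subrr.
by apply: fi; rewrite fx linear0.
Qed.

(** Preimages under [k] are unique, so any choice of them is automatically linear. *)
Lemma lift_inj K V U (k : {linear K -> V}) (f : {linear U -> V}) :
  injective k -> (forall u, exists x, k x = f u) ->
  exists g : {linear U -> K}, forall u, k (g u) = f u.
Proof.
move=> ki /choice[g gE].
have lg : linear g by move=> a u v; apply: ki; rewrite linearP !gE linearP.
by have [h hE] := linear_exists lg; exists h => u; rewrite hE.
Qed.

(** [f] is constant on the fibres of [q], so composing it with any section of [q] gives a linear
    map. *)
Lemma lift_surj V Q W (q : {linear V -> Q}) (f : {linear V -> W}) :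
  surj q -> (forall v, q v = 0 -> f v = 0) ->
  exists g : {linear Q -> W}, forall v, g (q v) = f v.
Proof.
move=> /choice[s sE] q0.
have E u v : q u = q v -> f u = f v.
  move=> quv; apply/eqP; rewrite -subr_eq0; apply/eqP.
  by rewrite -linearB q0 // linearB quv subrr.
have lg : linear (f \o s).
  by move=> a u v /=; rewrite -linearP; apply: E; rewrite linearP !sE.
have [h hE] := linear_exists lg; exists h => u; rewrite hE /=.
by apply: E; rewrite sE.
Qed.

Lemma submod_incl_inj V (W : submodClosed V) : injective (submod_incl W).
Proof. exact: val_inj. Qed.

Lemma submod_inclP V (W : submodClosed V) (v : V) :
  v \in W <-> exists x, submod_incl W x = v.
Proof.
split=> [vW|[x <-]]; first by exists (Submod vW).
exact: (valP x).
Qed.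

Lemma submod_incl_in V (W : submodClosed V) (x : submod W) :
  submod_incl W x \in W.
Proof. exact: (valP x). Qed.

Lemma quot_pi_surj V (W : submodClosed V) : surj (quot_pi W).
Proof. by move=> x; exists (repr (x : Quotient.quot _)); rewrite quot_piK. Qed.

Lemma quot_pi0 V (W : submodClosed V) (v : V) : quot_pi W v = 0 <-> v \in W.
Proof. by rewrite -(linear0 (quot_pi W)) quot_pi_eq subr0. Qed.

Lemma kernelP U V (f : {linear U -> V}) u : u \in kernel f <-> f u = 0.
Proof. by split=> [/eqP//|fu]; apply/eqP. Qed.

Lemma imageP U V (f : {linear U -> V}) v :
  v \in image_submod f <-> exists u, f u = v.
Proof. by split=> [/asboolP//|?]; apply/asboolP. Qed.

Lemma preimP U V (f : {linear U -> V}) (W : submodClosed V) u :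
  u \in preim_submod f W <-> f u \in W.
Proof. by []. Qed.

Lemma corestrict U V (f : {linear U -> V}) :
  exists g : {linear U -> submod (image_submod f)},
    surj g /\ forall u, submod_incl _ (g u) = f u.
Proof.
have [u|g gE] := @lift_inj _ _ _ (submod_incl (image_submod f)) f
  (@submod_incl_inj _ _); first by apply/submod_inclP/imageP; exists u.
exists g; split=> // y; have /imageP[u fu] := submod_incl_in y.
by exists u; apply: submod_incl_inj; rewrite gE fu.
Qed.

Definition ses U V W (i : {linear U -> V}) (p : {linear V -> W}) :=
  [/\ injective i, surj p & forall v, p v = 0 <-> exists u, i u = v].

Lemma ses0 U V W (i : {linear U -> V}) (p : {linear V -> W}) u :
  ses i p -> p (i u) = 0.
Proof. by case=> _ _ e; apply/e; exists u. Qed.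

Lemma ses_quot V (W : submodClosed V) : ses (submod_incl W) (quot_pi W).
Proof.
split; [exact: submod_incl_inj|exact: quot_pi_surj|].
by move=> v; rewrite quot_pi0 submod_inclP.
Qed.

Lemma ses_kernel U V (f : {linear U -> V}) : surj f -> ses (submod_incl (kernel f)) f.
Proof.
split=> //; first exact: submod_incl_inj.
by move=> v; rewrite -kernelP submod_inclP.
Qed.

Lemma free_hom_ext (K : choiceType) V (f g : {linear free_mod R K -> V}) :
  (forall k, f (free_gen R k) = g (free_gen R k)) -> f =1 g.
Proof.
move=> fg x; rewrite -[x](freeg.freeg_sumE).
rewrite (raddf_sum f) (raddf_sum g); apply: eq_bigr => k _.
have -> : freeg.Freeg [:: (freeg.coeff k x, k)] =
    (freeg.coeff k x *: free_gen R k : free_mod R K).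
  apply/eqP/freeg.freeg_eqP => y; rewrite [RHS]freeg.coeffZ.
  by rewrite /free_gen !freeg.coeffU mul1r.
apply: etrans (linearZZ f _ _) _; rewrite fg; exact/esym/(linearZZ g).
Qed.

Definition projective (P : lmodType R) :=
  forall B C (p : {linear B -> C}) (c : {linear P -> C}),
  surj p -> exists b : {linear P -> B}, forall x, p (b x) = c x.

Lemma free_projective (K : choiceType) : projective (free_mod R K).
Proof.
move=> B C p c /choice[s sE].
exists (free_lift (fun k => s (c (free_gen R k)))) => x.
apply: (free_hom_ext (f := p \o _) (g := c)) => k /=.
by rewrite free_lift_gen.
Qed.

End Linear.

(** * Finite generation over a Noetherian ring *)

Section LinearCombinations.
Variables (R : comNzRingType).
Implicit Types U V W : lmodType R.

(** Recursive form of the spanning condition in [fin_gen]: peeling off one generator at a time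
    replaces manipulations of indexed sums by inductions on the list. *)
Fixpoint lc V (s : seq V) (v : V) : Prop :=
  if s is x :: s' then exists a, lc s' (v - a *: x) else v = 0.

Lemma lcE V (s : seq V) v :
  lc s v <-> exists c : 'I_(size s) -> R, v = \sum_(i < size s) c i *: s`_i.
Proof.
elim: s v => [|x s IH] v /=.
  split=> [->|[c ->]]; last by rewrite big_ord0.
  by exists (fun=> 0); rewrite big_ord0.
split=> [[a /IH[c e]]|[c ->]].
  exists (fun i => if unlift ord0 i is Some j then c j else a).
  rewrite big_ord_recl unlift_none /=; under eq_bigr do rewrite liftK.
  by rewrite -e addrC subrK.
exists (c ord0); apply/IH; exists (fun j => c (lift ord0 j)).
by rewrite big_ord_recl /= addrC addKr.
Qed.

Lemma fin_genP V : fin_gen V <-> exists s : seq V, forall v, lc s v.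
Proof. by split=> -[s sv]; exists s => v; apply/lcE/sv. Qed.

Lemma lc0 V (s : seq V) : lc s 0.
Proof. by elim: s => //= x s IH; exists 0; rewrite scale0r subr0. Qed.

Lemma lcP V (s : seq V) a u v : lc s u -> lc s v -> lc s (a *: u + v).
Proof.
elim: s u v => [|x s IH] u v /=; first by move=> -> ->; rewrite scaler0 addr0.
move=> [b bu] [c cv]; exists (a * b + c).
have -> : a *: u + v - (a * b + c) *: x = a *: (u - b *: x) + (v - c *: x).
  by rewrite scalerBr scalerDl opprD scalerA addrACA.
exact: IH.
Qed.

Lemma lc_cat V (s t : seq V) u v : lc s u -> lc t v -> lc (s ++ t) (u + v).
Proof.
elim: s u => [|x s IH] u /=; first by move=> ->; rewrite add0r.
by move=> [a au] tv; exists a; rewrite addrAC; apply: IH.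
Qed.

Lemma lc_map U V (f : {linear U -> V}) s u : lc s u -> lc (map f s) (f u).
Proof.
elim: s u => [|x s IH] u /=; first by move=> ->; rewrite linear0.
by move=> [a /IH]; rewrite linearB linearZ; exists a.
Qed.

Lemma lc_map_inj U V (f : {linear U -> V}) s u :
  injective f -> lc (map f s) (f u) -> lc s u.
Proof.
move=> fi; elim: s u => [|x s IH] u /=; first by move/(proj2 (lin_injP f) fi).
by move=> [a]; rewrite -linearZ -linearB => /IH; exists a.
Qed.

Lemma lc_in V (W : submodClosed V) s u :
  (forall x, x \in s -> x \in W) -> lc s u -> u \in W.
Proof.
elim: s u => [|x s IH] u /= sW; first by move=> ->; rewrite rpred0.
move=> [a /IH H]; rewrite -[u](subrK (a *: x)) rpredD ?rpredZ //.
  by apply: H => y ys; rewrite sW // inE ys orbT.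
by rewrite sW // inE eqxx.
Qed.

Lemma lc_mem V (s : seq V) x : x \in s -> lc s x.
Proof.
elim: s => //= y s IH; rewrite inE => /orP[/eqP->|/IH xs].
  by exists 1; rewrite scale1r subrr; apply: lc0.
by exists 0; rewrite scale0r subr0.
Qed.

Lemma fg_surj U V (f : {linear U -> V}) : surj f -> fin_gen U -> fin_gen V.
Proof.
move=> fs /fin_genP[s su]; apply/fin_genP; exists (map f s) => v.
by have [u <-] := fs v; apply: lc_map.
Qed.

Lemma fg_ext U V W (i : {linear U -> V}) (p : {linear V -> W}) :
  surj p -> (forall v, p v = 0 -> exists u, i u = v) ->
  fin_gen U -> fin_gen W -> fin_gen V.
Proof.
move=> /choice[q qK] ex /fin_genP[s su] /fin_genP[t tw].
apply/fin_genP; exists (map q t ++ map i s) => v.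
have lift r w : lc r w -> exists2 u, lc (map q r) u & p u = w.
  elim: r w => [|x r IH] w /=; first by move=> ->; exists 0; rewrite ?linear0.
  move=> [a /IH[u ru pu]]; exists (u + a *: q x).
    by exists a; rewrite addrK.
  by rewrite linearD linearZ /= qK pu subrK.
have [u qu pu] := lift t (p v) (tw _).
have [|x ix] := ex (v - u); first by rewrite linearB pu subrr.
by rewrite -[v](subrK u) -ix addrC; apply: lc_cat => //; apply: lc_map.
Qed.

Lemma submodB V (W : submodClosed V) u v : u \in W -> v \in W -> u - v \in W.
Proof. by move=> uW vW; rewrite -scaleN1r rpredD ?rpredZ. Qed.

Lemma fg0 V : (forall v : V, v = 0) -> fin_gen V.
Proof. by move=> V0; apply/fin_genP; exists [::]. Qed.

Lemma fg_submodP V (W : submodClosed V) : fin_gen (submod W) <->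
  exists s : seq V, (forall x, x \in s -> x \in W) /\ forall w, w \in W -> lc s w.
Proof.
split=> [/fin_genP[s sw]|[s [sW sw]]].
  exists (map (submod_incl W) s); split=> [_ /mapP[x _ ->]|w wW].
    exact: (valP x).
  exact: (lc_map (submod_incl W) (sw (Submod wW))).
have [t ts] : exists t : seq (submod W), map (submod_incl W) t = s.
  elim: s sW {sw} => [|x s IH] sW; first by exists [::].
  have [y ys|t <-] := IH; first by rewrite sW // inE ys orbT.
  have xW : x \in W by rewrite sW // inE eqxx.
  by exists (Submod xW :: t).
apply/fin_genP; exists t => v.
apply: (lc_map_inj (@submod_incl_inj _ _ W)); rewrite ts; apply: sw.
exact: submod_incl_in.
Qed.

Section Noetherian.
Hypothesis noethR : noetherian R.

(** Induction on [s]: the coefficients of the first generator that occur in elements of [W] form an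
    ideal, which is finitely generated. Elements of [W] lifting its generators, together with
    generators of the part of [W] spanned by the remaining list, generate [W]. *)
Lemma noeth_sub V (s : seq V) (W : submodClosed V) :
  (forall w, w \in W -> lc s w) ->
  exists t : seq V, (forall x, x \in t -> x \in W) /\ forall w, w \in W -> lc t w.
Proof.
elim: s W => [|x s IH] W sW; first by exists [::].
pose J (a : R^o) : Prop := exists2 v, lc s v & (a : R) *: x + v \in W.
have cJ : J 0 /\ forall (a : R) b c, J b -> J c -> J (a *: b + c).
  split=> [|a b c [u su uW] [v sv vW]].
    by exists 0; rewrite ?scale0r ?addr0 ?rpred0 //; apply: lc0.
  exists (a *: u + v); first exact: lcP.
  rewrite scalerDl -scalerA addrACA -scalerDr.
  by rewrite rpredD // rpredZ.
have [js jP] := proj1 (fin_genP _) (noethR (@prop_submod R R^o J cJ)).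
have /choice[w wP] : forall j : submod (@prop_submod R R^o J cJ),
    exists w, w \in W /\ lc s (w - (submod_val j) *: x).
  move=> j; have /mem_prop_submod[v sv vW] := valP j.
  by exists (submod_val j *: x + v); split=> //; rewrite addrC addKr.
(* The elements of [W] that are combinations of [s] alone; the induction hypothesis applies to
   them. *)
have cW : ((0 : V) \in W /\ lc s 0) /\ forall a (u v : V),
   (u \in W /\ lc s u) -> (v \in W /\ lc s v) ->
   a *: u + v \in W /\ lc s (a *: u + v).
  split=> [|a u v [uW su] [vW sv]]; first by rewrite rpred0; split=> //; apply: lc0.
  by split; [rewrite rpredD // rpredZ|apply: lcP].
have [|t [tW tP]] := IH (prop_submod cW).
  by move=> v /mem_prop_submod[].
exists (map w js ++ t); split=> [y|v vW].
  rewrite mem_cat => /orP[/mapP[j _ ->]|/tW/mem_prop_submod[//]].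
  by have [] := wP j.
have /= [a sa] := sW _ vW.
have Ja : (a : R^o) \in @prop_submod R R^o J cJ.
  by apply/mem_prop_submod; exists (v - a *: x) => //; rewrite addrC subrK.
(* A combination of the chosen lifts with the same leading coefficient as [v]: subtracting it from
   [v] leaves a combination of [s]. *)
have [u lu [uW su]] : exists2 u, lc (map w js) u & u \in W /\ lc s (u - a *: x).
  move: (jP (Submod Ja)) => /(lc_map (submod_incl _)) /=.
  elim: js (a) {jP Ja sa} => [|j js IHj] b /=.
    by move=> ->; exists 0; rewrite // rpred0 scale0r subr0; split=> //; apply: lc0.
  move=> [c /IHj[u lu [uW su]]]; exists (u + c *: w j); first by exists c; rewrite addrK.
  have [wW sw] := wP j; split; first by rewrite rpredD // rpredZ.
  have -> : u + c *: w j - b *: x =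
    c *: (w j - submod_val j *: x) + (u - (b - c *: (submod_val j : R^o)) *: x).
    rewrite scalerBr scalerBl scalerA opprB.
    rewrite [(c * _)]/(c *: (submod_val j : R^o)).
    by rewrite [RHS]addrACA addKr [u + _]addrC.
  exact: lcP.
rewrite -[v](subrK u) addrC; apply: lc_cat => //.
apply: tP; apply/mem_prop_submod; split; first exact: submodB.
have -> : v - u = -1 *: (u - a *: x) + (v - a *: x).
  by rewrite scaleN1r opprB [RHS]addrC addrA subrK.
exact: lcP.
Qed.

Lemma fg_submod V (W : submodClosed V) : fin_gen V -> fin_gen (submod W).
Proof.
move=> /fin_genP[s sv]; apply/fg_submodP; apply: (noeth_sub (s := s)) => w _.
exact: sv.
Qed.

Lemma fg_inj U V (f : {linear U -> V}) : injective f -> fin_gen V -> fin_gen U.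
Proof.
move=> fi fgV; have [g [gs gE]] := corestrict f.
have [u|h hE] := @lift_inj _ _ _ _ f (submod_incl (image_submod f)) fi.
  exact/imageP/submod_incl_in.
apply: (fg_surj (f := h)); last exact: fg_submod.
move=> u; exists (g u); apply: fi; rewrite hE.
exact: gE.
Qed.

(* The span [X <- Y -> W] plays the role of a homomorphism from a submodule
   of [X] to [W / im g]. *)
Lemma fg_span (Y X Z W : lmodType R) (al : {linear Y -> X}) (be : {linear Y -> W})
    (g : {linear Z -> W}) :
  fin_gen X -> fin_gen Z -> surj be ->
  (forall y, al y = 0 -> exists z, g z = be y) -> fin_gen W.
Proof.
move=> fgX fgZ bes ex; have [al' [als alE]] := corestrict al.
pose q := quot_pi (image_submod g).
have [y ay|h hE] := @lift_surj _ _ _ _ al' (q \o be) als.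
  apply/quot_pi0/imageP/ex; rewrite -alE ay; exact: linear0.
apply: (fg_ext (i := g) (p := q)) => //.
- exact: quot_pi_surj.
- by move=> v /quot_pi0/imageP.
apply: (fg_surj (f := h)); last exact: fg_submod.
move=> w; have [v <-] := quot_pi_surj w; have [y <-] := bes v.
by exists (al' y); rewrite hE.
Qed.

(** The union of the chain is a finitely generated submodule, and some member of the chain already
    contains its generators. *)
Lemma acc V (W : nat -> submodClosed V) : fin_gen V ->
  (forall n v, v \in W n -> v \in W n.+1) ->
  exists n, forall m v, v \in W m -> v \in W n.
Proof.
move=> fgV Winc.
have Wle m n v : (m <= n)%N -> v \in W m -> v \in W n.
  move=> /subnK <-; elim: (n - m)%N => //= k IH /IH; exact: Winc.
have cU : (exists n, (0 : V) \in W n) /\ forall a (u v : V),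
    (exists n, u \in W n) -> (exists n, v \in W n) -> exists n, a *: u + v \in W n.
  split=> [|a u v [m um] [n vn]]; first by exists 0%N; rewrite rpred0.
  exists (maxn m n); rewrite rpredD ?rpredZ //.
    by apply: Wle um; rewrite leq_maxl.
  by apply: Wle vn; rewrite leq_maxr.
have /fg_submodP[s [sU Us]] := fg_submod (prop_submod cU) fgV.
have [n sn] : exists n, forall x, x \in s -> x \in W n.
  elim: s sU {Us} => [|x s IH] sU; first by exists 0%N.
  have [y ys|n nP] := IH; first by rewrite sU // inE ys orbT.
  have /mem_prop_submod[m xm] : x \in prop_submod cU by rewrite sU // inE eqxx.
  exists (maxn m n) => y; rewrite inE => /orP[/eqP->|/nP].
    by apply: Wle xm; rewrite leq_maxl.
  by apply: Wle; rewrite leq_maxr.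
exists n => m v vm; apply: (lc_in sn); apply: Us.
by apply/mem_prop_submod; exists m.
Qed.

(** Without a maximal member, dependent choice would produce a strictly ascending chain, against
    [acc]. *)
Lemma noeth_max V (P : submodClosed V -> Prop) (W0 : submodClosed V) :
  fin_gen V -> P W0 -> exists W : submodClosed V,
    [/\ P W, (forall v, v \in W0 -> v \in W) &
    forall W' : submodClosed V, P W' -> (forall v, v \in W -> v \in W') ->
      forall v, v \in W' -> v \in W].
Proof.
move=> fgV PW0.
pose T := {W : submodClosed V | P W /\ forall v, v \in W0 -> v \in W}.
apply: contrapT => nomax.
have step (W : T) : exists W' : T,
    (forall v, v \in sval W -> v \in sval W') /\ exists2 v, v \in sval W' & v \notin sval W.
  case: W => W [PW W0W] /=; apply: contrapT => no; apply: nomax.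
  exists W; split=> // W' PW' WW' v vW'; apply: contrapT => /negP nvW.
  apply: no; unshelve eexists (exist _ W' _).
    by split=> // u /W0W/WW'.
  by split=> //; exists v.
have [f fP] := choice step.
pose W n := iter n f (exist _ W0 (conj PW0 (fun v (h : v \in W0) => h)) : T).
have [n nP] := acc (W := fun n => sval (W n)) fgV (fun n => (fP (W n)).1).
have [_ [v vW nvW]] := fP (W n).
by move: nvW; rewrite (nP n.+1).
Qed.

End Noetherian.
End LinearCombinations.

(** * Finiteness in the long exact sequence *)

Section Cohomology.
Variables (R : comNzRingType).
Hypothesis noethR : noetherian R.
Implicit Types X Y S A B C M H : lmodType R.

(** The image of [ta] is a quotient of the image of [si], a submodule of [Z]. *)
Lemma fg_image (S Z W : lmodType R) (si : {linear S -> Z})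
    (ta : {linear S -> W}) :
  fin_gen Z -> (forall s, si s = 0 -> ta s = 0) ->
  fin_gen (submod (image_submod ta)).
Proof.
move=> fgZ st; have [si' [sis siE]] := corestrict si.
have [ta' [tas taE]] := corestrict ta.
have [s s0|h hE] := @lift_surj _ _ _ _ si' ta' sis.
  apply: submod_incl_inj; rewrite taE linear0; apply: st.
  by rewrite -siE s0 linear0.
apply: (fg_surj (f := h)); last exact: fg_submod.
by move=> y; have [s <-] := tas y; exists (si' s).
Qed.

(** This is the fact that the middle term of an exact sequence [Z -> W -> X] is finitely generated
    when the outer ones are. The two maps are replaced by correspondences through [S] and [Y]. In
    the applications [X], [Z], [W] are cohomology modules and [S], [Y] are modules of cochains, so
    that no map between cohomology modules has to be constructed. *)
Lemma fg_span2 (Y X S Z W : lmodType R) (al : {linear Y -> X})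
    (be : {linear Y -> W}) (si : {linear S -> Z}) (ta : {linear S -> W}) :
  fin_gen X -> fin_gen Z -> surj be ->
  (forall s, si s = 0 -> ta s = 0) ->
  (forall y, al y = 0 -> exists s, ta s = be y) -> fin_gen W.
Proof.
move=> fgX fgZ bes st ex.
apply: (fg_span noethR (al := al) (g := submod_incl (image_submod ta)) fgX) bes _.
  exact: fg_image st.
by move=> y /ex[s <-]; apply/submod_inclP/imageP; exists s.
Qed.

Definition cocycle X1 X2 (d1 : {linear X2 -> X1}) M (c : {linear X1 -> M}) :=
  forall x, c (d1 x) = 0.

Definition cobound X0 X1 (d0 : {linear X1 -> X0}) M (c : {linear X1 -> M}) :=
  exists h : {linear X0 -> M}, forall x, c x = h (d0 x).

(* [H] is the cohomology of [Hom X0 M -> Hom X1 M -> Hom X2 M], where [cl]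
   maps a cocycle to its class. *)
Definition is_cohomology X0 X1 X2 (d0 : {linear X1 -> X0}) (d1 : {linear X2 -> X1})
    M H :=
  exists cl : Hom X1 M -> H,
  [/\ forall a (c c' : Hom X1 M), cocycle d1 c -> cocycle d1 c' ->
        cl (a *: c + c') = a *: cl c + cl c',
      forall h, exists2 c : Hom X1 M, cocycle d1 c & cl c = h &
      forall c : Hom X1 M, cocycle d1 c -> (cl c = 0 <-> cobound d0 c)].

Lemma postcomp_exists X M M' (p : {linear M -> M'}) :
  exists f : {linear Hom X M -> Hom X M'}, forall c x, f c x = p (c x).
Proof.
have lf : linear (fun c : Hom X M => (p \o (c : {linear X -> M}) : Hom X M')).
  by move=> a c c'; apply: hom_ext => x /=; rewrite linearP.
by have [f fE] := linear_exists lf; exists f => c x; rewrite fE.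
Qed.

Section Class.
Variables (X0 X1 X2 : lmodType R) (d0 : {linear X1 -> X0}) (d1 : {linear X2 -> X1}).
Variables (M H : lmodType R) (cl : Hom X1 M -> H).
Hypothesis clP : [/\ forall a (c c' : Hom X1 M), cocycle d1 c -> cocycle d1 c' ->
        cl (a *: c + c') = a *: cl c + cl c',
      forall h, exists2 c : Hom X1 M, cocycle d1 c & cl c = h &
      forall c : Hom X1 M, cocycle d1 c -> (cl c = 0 <-> cobound d0 c)].

(** [cl] is linear only on cocycles, so it becomes a linear map after composition with a linear
    family of cocycles. *)
Lemma cl_map Y (f : {linear Y -> Hom X1 M}) : (forall y, cocycle d1 (f y)) ->
  exists al : {linear Y -> H}, forall y, al y = cl (f y).
Proof.
move=> fc; case: clP => clL _ _.
have la : linear (cl \o f) by move=> a u v /=; rewrite linearP clL.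
by have [al alE] := linear_exists la; exists al => y; rewrite alE.
Qed.

Lemma cl_eq (c c' : Hom X1 M) :
  cocycle d1 c -> cocycle d1 c' -> cobound d0 (c - c' : Hom X1 M) ->
  cl c = cl c'.
Proof.
move=> cc cc'; case: clP => clL _ cl0 b.
have e : c = 1 *: (c - c') + c' :> Hom X1 M.
  apply: hom_ext => x; rewrite -[RHS]/(1 *: (c x - c' x) + c' x).
  by rewrite scale1r subrK.
rewrite e.
have ccB : cocycle d1 (c - c' : Hom X1 M).
  by move=> x; rewrite /= -[LHS]/(c (d1 x) - c' (d1 x)) cc cc' subrr.
by rewrite clL // (proj2 (cl0 _ ccB) b) scaler0 add0r.
Qed.

Lemma cl_eq0 (c : Hom X1 M) : cocycle d1 c -> cobound d0 c -> cl c = 0.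
Proof. by case: clP => _ _ cl0 cc b; apply/cl0. Qed.

Lemma cl_eq0_inv (c : Hom X1 M) : cocycle d1 c -> cl c = 0 -> cobound d0 c.
Proof. by case: clP => _ _ cl0 cc /cl0; apply. Qed.

End Class.

Lemma cocycle_map X1 X2 (d1 : {linear X2 -> X1}) M M' (p : {linear M -> M'})
  (c : Hom X1 M) (c' : Hom X1 M') :
  (forall x, c' x = p (c x)) -> cocycle d1 c -> cocycle d1 c'.
Proof. by move=> e cc x; rewrite e cc linear0. Qed.

Lemma cochains_exist X M (P : Hom X M -> Prop) :
  P 0 -> (forall a u v, P u -> P v -> P (a *: u + v)) ->
  exists (Y : lmodType R) (y : {linear Y -> Hom X M}),
    [/\ injective y, forall t, P (y t) & forall c, P c -> exists t, y t = c].
Proof.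
move=> P0 Pl; have cP := conj P0 Pl.
exists (submod (prop_submod cP)), (submod_incl (prop_submod cP)); split.
- exact: submod_incl_inj.
- by move=> t; apply/(mem_prop_submod cP)/submod_incl_in.
by move=> c Pc; apply/submod_inclP/mem_prop_submod.
Qed.

(** The module of cochains in [M] that become cocycles in [M']. For [p] the identity these are the
    cocycles of [M]; for a surjection they are lifts of cocycles of [M']. *)
Lemma cocycles_exist X1 X2 (d1 : {linear X2 -> X1}) M M' (p : {linear M -> M'}) :
  exists (Y : lmodType R) (y : {linear Y -> Hom X1 M}),
    [/\ injective y, forall t x, p (y t (d1 x)) = 0 &
        forall c : Hom X1 M, (forall x, p (c (d1 x)) = 0) -> exists t, y t = c].
Proof.
have [||Y [y [yi yP yE]]] :=
  @cochains_exist X1 M (fun c => forall x, p (c (d1 x)) = 0).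
- by move=> x; rewrite linear0.
- by move=> a u v u0 v0 x; rewrite -[LHS]/(p (a *: u (d1 x) + v (d1 x)))
    linearP u0 v0 scaler0 addr0.
by exists Y, y.
Qed.

Section LongExact.
Variables (A B C : lmodType R) (i : {linear A -> B}) (p : {linear B -> C}).
Hypothesis ip : ses i p.

Section Middle.
Variables (X0 X1 X2 : lmodType R) (d0 : {linear X1 -> X0}) (d1 : {linear X2 -> X1}).
Hypotheses (dd : forall x, d0 (d1 x) = 0).
Variables (HA HB HC : lmodType R).
Hypotheses (cA : is_cohomology d0 d1 A HA) (cB : is_cohomology d0 d1 B HB)
  (cC : is_cohomology d0 d1 C HC).

(** Exactness of the cohomology sequence at [HB]. *)
Lemma coh_mid : projective X0 -> fin_gen HA -> fin_gen HC -> fin_gen HB.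
Proof.
case: ip => ii ps ex pr0 fA fC.
have [clA clAP] := cA; have [clB clBP] := cB; have [clC clCP] := cC.
have [Y [y [_ yP yE]]] := cocycles_exist d1 (idfun : {linear B -> B}).
have [S [s [_ sP sE]]] := cocycles_exist d1 (idfun : {linear A -> A}).
have [pp ppE] := postcomp_exists X1 p; have [ii' iiE] := postcomp_exists X1 i.
have yc t : cocycle d1 (y t) by exact: yP.
have sc t : cocycle d1 (s t) by exact: sP.
have pc t : cocycle d1 ((pp \o y) t) by apply: cocycle_map (yc t) => x; rewrite ppE.
have ic t : cocycle d1 ((ii' \o s) t) by apply: cocycle_map (sc t) => x; rewrite iiE.
have [al alE] := cl_map clCP pc; have [be beE] := cl_map clBP yc.
have [si siE] := cl_map clAP sc; have [ta taE] := cl_map clBP ic.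
apply: (fg_span2 (al := al) (be := be) (si := si) (ta := ta)) => //.
- move=> h; case: clBP => _ /(_ h)[c cc <-] _; have [t tc] := yE c cc.
  by exists t; rewrite beE tc.
- move=> t; rewrite siE => /(cl_eq0_inv clAP (sc t))[h hE].
  rewrite taE; apply: cl_eq0 clBP _ (ic t) _.
  by exists (i \o h) => x; rewrite /= iiE hE.
move=> t; rewrite alE => /(cl_eq0_inv clCP (pc t))[h hE].
(* The cochain that bounds the image in [C] lifts to [B] by projectivity; subtracting its coboundary
   moves the cocycle into [A] without changing its class. *)
have [h' h'E] := pr0 _ _ p h ps.
have [|a aE] := @lift_inj _ _ _ _ i (y t \- (h' \o d0)) ii.
  move=> x; apply/ex => /=; rewrite linearB /= h'E -hE ppE; exact: subrr.
have [|t' t'E] := sE (a : Hom X1 A).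
  by move=> x; apply: ii; rewrite aE /= linear0 yc dd linear0 subrr.
exists t'; rewrite taE beE; apply: (cl_eq clBP (ic t') (yc t)).
exists (\- h') => x; rewrite -[LHS]/(ii' (s t') x - y t x) iiE t'E aE /=.
by rewrite addrAC subrr add0r.
Qed.

(** When [d0] is zero there are no nonzero coboundaries, so [HA] embeds in [HB]. *)
Lemma coh_inj : (forall x, d0 x = 0) -> fin_gen HB -> fin_gen HA.
Proof.
case: ip => ii ps ex d00 fB.
have [clA clAP] := cA; have [clB clBP] := cB.
have [S [s [_ sP sE]]] := cocycles_exist d1 (idfun : {linear A -> A}).
have [ii' iiE] := postcomp_exists X1 i.
have sc t : cocycle d1 (s t) by exact: sP.
have ic t : cocycle d1 ((ii' \o s) t) by apply: cocycle_map (sc t) => x; rewrite iiE.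
have [si siE] := cl_map clAP sc; have [ta taE] := cl_map clBP ic.
apply: (fg_span2 (al := ta) (be := si) (si := ta) (ta := si)) => //.
- move=> h; case: clAP => _ /(_ h)[c cc <-] _; have [t tc] := sE c cc.
  by exists t; rewrite siE tc.
- move=> t; rewrite taE => /(cl_eq0_inv clBP (ic t))[h hE].
  rewrite siE; apply: cl_eq0 clAP _ (sc t) _.
  exists \0 => x; apply: ii; rewrite linear0 -iiE; apply: etrans (hE x) _.
  by rewrite d00 linear0.
by move=> t _; exists t.
Qed.

End Middle.

Section Shift.
Variables (X0 X1 X2 X3 : lmodType R) (d0 : {linear X1 -> X0})
  (d1 : {linear X2 -> X1}) (d2 : {linear X3 -> X2}).
Hypotheses (dd : forall x, d0 (d1 x) = 0) (dd' : forall x, d1 (d2 x) = 0).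

(** The connecting homomorphism on cochains: if a cochain of [B] becomes a cocycle in [C], its
    coboundary takes values in [A]. *)
Lemma connecting Y (y : {linear Y -> Hom X1 B}) :
  (forall t x, p (y t (d1 x)) = 0) ->
  exists g : {linear Y -> Hom X2 A}, forall t x, i (g t x) = y t (d1 x).
Proof.
case: ip => ii ps ex yP.
have [ii' iiE] := postcomp_exists X2 i.
have [||g gE] := @lift_inj _ _ _ _ ii' (precomp B d1 \o y).
- by move=> c c' e; apply: hom_ext => x; apply: ii; rewrite -!iiE e.
- move=> t; have [|a aE] := @lift_inj _ _ _ _ i (y t \o d1) ii.
    by move=> x; apply/ex/yP.
  by exists a; apply: hom_ext => x; rewrite iiE aE.
by exists g => t x; rewrite -iiE gE.
Qed.

(** Exactness at [HC], between [HB] and the next cohomology of [A]. The projectivity of [X1] lifts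
    cocycles of [C] to cochains of [B]. *)
Lemma coh_right HB HC HA' :
  is_cohomology d0 d1 B HB -> is_cohomology d0 d1 C HC -> is_cohomology d1 d2 A HA' ->
  projective X1 -> fin_gen HB -> fin_gen HA' -> fin_gen HC.
Proof.
move=> [clB clBP] [clC clCP] [clA clAP] pr1 fB fA.
case: (ip) => ii ps ex.
have [Y [y [_ yP yE]]] := cocycles_exist d1 p.
have [S [s [_ sP sE]]] := cocycles_exist d1 (idfun : {linear B -> B}).
have [pp ppE] := postcomp_exists X1 p.
have [g gE] := connecting yP.
have sc t : cocycle d1 (s t) by exact: sP.
have gc t : cocycle d2 (g t).
  by move=> x; apply: ii; rewrite gE dd' !linear0.
have pc t : cocycle d1 ((pp \o y) t) by move=> x /=; rewrite ppE yP.
have psc t : cocycle d1 ((pp \o s) t) by move=> x /=; rewrite ppE sc linear0.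
have [al alE] := cl_map clAP gc; have [be beE] := cl_map clCP pc.
have [si siE] := cl_map clBP sc; have [ta taE] := cl_map clCP psc.
apply: (fg_span2 (al := al) (be := be) (si := si) (ta := ta)) => //.
- move=> h; case: clCP => _ /(_ h)[c cc <-] _.
  have [b bE] := pr1 _ _ p c ps.
  have [|t tb] := yE b; first by move=> x; rewrite bE.
  by exists t; rewrite beE /= tb; congr clC; apply: hom_ext => x; rewrite ppE.
- move=> t; rewrite siE => /(cl_eq0_inv clBP (sc t))[h hE].
  rewrite taE; apply: cl_eq0 clCP _ (psc t) _.
  by exists (p \o h) => x; rewrite /= ppE hE.
move=> t; rewrite alE => /(cl_eq0_inv clAP (gc t))[a aE].
have [|t' t'E] := sE (y t \- (i \o a) : Hom X1 B).
  by move=> x /=; rewrite -gE aE subrr.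
exists t'; rewrite taE beE; congr clC; apply: hom_ext => x /=.
by rewrite !ppE t'E linearB /= (ses0 _ ip) subr0.
Qed.

(** Exactness at [HA'], between the previous cohomology of [C] and [HB']. The projectivity of [X0]
    shows that the connecting map sends coboundaries to coboundaries. *)
Lemma coh_left HC HA' HB' :
  is_cohomology d0 d1 C HC -> is_cohomology d1 d2 A HA' -> is_cohomology d1 d2 B HB' ->
  projective X0 -> fin_gen HC -> fin_gen HB' -> fin_gen HA'.
Proof.
move=> [clC clCP] [clA clAP] [clB clBP] pr0 fC fB.
case: (ip) => ii ps ex.
have [Y [y [_ yP yE]]] := cocycles_exist d2 (idfun : {linear A -> A}).
have [S [s [_ sP sE]]] := cocycles_exist d1 p.
have [pp ppE] := postcomp_exists X1 p; have [ii' iiE] := postcomp_exists X2 i.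
have [g gE] := connecting sP.
have yc t : cocycle d2 (y t) by exact: yP.
have gc t : cocycle d2 (g t).
  by move=> x; apply: ii; rewrite gE dd' !linear0.
have pc t : cocycle d1 ((pp \o s) t) by move=> x /=; rewrite ppE sP.
have ic t : cocycle d2 ((ii' \o y) t) by move=> x /=; rewrite iiE yc linear0.
have [al alE] := cl_map clBP ic; have [be beE] := cl_map clAP yc.
have [si siE] := cl_map clCP pc; have [ta taE] := cl_map clAP gc.
apply: (fg_span2 (al := al) (be := be) (si := si) (ta := ta)) => //.
- move=> h; case: clAP => _ /(_ h)[c cc <-] _; have [t tc] := yE c cc.
  by exists t; rewrite beE tc.
- move=> t; rewrite siE => /(cl_eq0_inv clCP (pc t))[h hE].
  rewrite taE; apply: cl_eq0 clAP _ (gc t) _.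
  have [h' h'E] := pr0 _ _ p h ps.
  have [|a aE] := @lift_inj _ _ _ _ i (s t \- (h' \o d0)) ii.
    move=> x; apply/ex => /=; rewrite linearB /= h'E -hE ppE; exact: subrr.
  exists a => x; apply: ii; rewrite gE aE /= dd linear0 subr0 //.
move=> t; rewrite alE => /(cl_eq0_inv clBP (ic t))[b bE].
have [|t' t'E] := sE (b : Hom X1 B).
  by move=> x; rewrite -bE /= iiE (ses0 _ ip).
exists t'; rewrite taE beE; congr clA; apply: hom_ext => x.
by apply: ii; rewrite gE t'E -bE /= iiE.
Qed.

End Shift.
End LongExact.

(* Multiplication by [a] is zero on the cohomology of [M], but factors through
   that of [a M = M / (0 :_M a)]. *)
Section Multiplication.
Variables (a : R) (K M Q : lmodType R) (k : {linear K -> M}) (q : {linear M -> Q}).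
Hypotheses (ki : injective k) (kE : forall m, a *: m = 0 <-> exists x, k x = m).
Hypotheses (qs : surj q) (qE : forall m, q m = 0 <-> exists m', a *: m' = m).

(** In degree 0 a coboundary is zero, so [a] kills every cocycle; cocycles of [M] thus take values
    in [K]. *)
Lemma coh_mul0 X0 X1 X2 (d0 : {linear X1 -> X0}) (d1 : {linear X2 -> X1}) HK HM :
  is_cohomology d0 d1 K HK -> is_cohomology d0 d1 M HM ->
  (forall c : Hom X1 M, cocycle d1 c -> cobound d0 (a *: c)) ->
  (forall x, d0 x = 0) -> fin_gen HK -> fin_gen HM.
Proof.
move=> [clK clKP] [clM clMP] anull d00 fK.
have [S [s [_ sP sE]]] := cocycles_exist d1 (idfun : {linear K -> K}).
have [kk kkE] := postcomp_exists X1 k.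
have sc t : cocycle d1 (s t) by exact: sP.
have kc t : cocycle d1 ((kk \o s) t) by apply: cocycle_map (sc t) => x; rewrite kkE.
have [si siE] := cl_map clKP sc; have [ta taE] := cl_map clMP kc.
apply: (fg_span2 (al := si) (be := ta) (si := si) (ta := ta)) => //.
- move=> h; case: clMP => _ /(_ h)[c cc <-] _.
  have [h' h'E] := anull c cc.
  have [|c' c'E] := @lift_inj _ _ _ _ k c ki.
    by move=> x; apply/kE; apply: etrans (h'E x) _; rewrite d00 linear0.
  have [|t tc] := sE (c' : Hom X1 K).
    by move=> x; apply: ki; rewrite c'E cc linear0.
  exists t; rewrite taE; congr clM; apply: hom_ext => x.
  by rewrite /= kkE tc c'E.
- move=> t; rewrite siE => /(cl_eq0_inv clKP (sc t))[h hE].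
  rewrite taE; apply: cl_eq0 clMP _ (kc t) _.
  by exists (k \o h) => x; rewrite /= kkE hE.
by move=> t _; exists t.
Qed.

(** The cohomology of [M] maps to that of [a M] with kernel coming from [HK]. Its image dies in the
    cohomology of [M], hence comes from [HQ] by the connecting map of [a M -> M -> Q]. Both
    contributions are finitely generated. *)
Lemma coh_mul X0 X1 X2 X3 (d0 : {linear X1 -> X0})
  (d1 : {linear X2 -> X1}) (d2 : {linear X3 -> X2}) HQ HK HM :
  (forall x, d0 (d1 x) = 0) -> (forall x, d1 (d2 x) = 0) ->
  is_cohomology d0 d1 Q HQ -> is_cohomology d1 d2 K HK -> is_cohomology d1 d2 M HM ->
  projective X0 -> projective X1 ->
  (forall c : Hom X2 M, cocycle d2 c -> cobound d1 (a *: c)) ->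
  fin_gen HQ -> fin_gen HK -> fin_gen HM.
Proof.
move=> dd dd' [clQ clQP] [clK clKP] [clM clMP] pr0 pr1 anull fQ fK.
have [S [s [_ sP sE]]] := cocycles_exist d2 (idfun : {linear K -> K}).
have [kk kkE] := postcomp_exists X2 k; have [qq qqE] := postcomp_exists X1 q.
have sc t : cocycle d2 (s t) by exact: sP.
have kc t : cocycle d2 ((kk \o s) t) by apply: cocycle_map (sc t) => x; rewrite kkE.
(* Pairs of a cocycle and a cochain bounding its multiple by [a]. Modulo [a M] the second component
   is a cocycle of [Q], which represents a preimage under the connecting map. *)
pose P (u : Hom X2 M * Hom X1 M) :=
  cocycle d2 u.1 /\ forall x, a *: u.1 x = u.2 (d1 x).
have cP : P 0 /\ forall b u v, P u -> P v -> P (b *: u + v).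
  split=> [|b u v [uc uE] [vc vE]]; first by split=> x //=; rewrite scaler0.
  split=> x; first by rewrite -[LHS]/(b *: u.1 (d2 x) + v.1 (d2 x)) uc vc scaler0 addr0.
  rewrite -[RHS]/(b *: u.2 (d1 x) + v.2 (d1 x)) -uE -vE.
  rewrite -[LHS]/(a *: (b *: u.1 x + v.1 x)).
  by rewrite scalerDr !scalerA [a * b]mulrC.
pose y := submod_incl (prop_submod cP).
have yP t : P (y t) by apply/(mem_prop_submod cP)/submod_incl_in.
have [f1 f1E] : exists f : {linear submod (prop_submod cP) -> Hom X2 M},
    forall t, f t = (y t).1.
  by apply: linear_exists => b u v; rewrite linearP.
have [f2 f2E] : exists f : {linear submod (prop_submod cP) -> Hom X1 M},
    forall t, f t = (y t).2.
  by apply: linear_exists => b u v; rewrite linearP.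
have f1c t : cocycle d2 (f1 t) by rewrite f1E; apply: (yP t).1.
have qc t : cocycle d1 ((qq \o f2) t).
  move=> x; rewrite /= qqE f2E -(yP t).2; apply/qE; by eexists.
have [al alE] := cl_map clQP qc; have [be beE] := cl_map clMP f1c.
have [si siE] := cl_map clKP sc; have [ta taE] := cl_map clMP kc.
apply: (fg_span2 (al := al) (be := be) (si := si) (ta := ta)) => //.
- move=> h; case: clMP => _ /(_ h)[c cc <-] _.
  have [h' h'E] := anull c cc.
  have Pc : P (c, (h' : Hom X1 M)) by split.
  have /submod_inclP[t tE] := proj2 (mem_prop_submod cP _) Pc.
  by exists t; rewrite beE f1E /y tE.
- move=> t; rewrite siE => /(cl_eq0_inv clKP (sc t))[h hE].
  rewrite taE; apply: cl_eq0 clMP _ (kc t) _.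
  by exists (k \o h) => x; rewrite /= kkE hE.
move=> t; rewrite alE => /(cl_eq0_inv clQP (qc t))[u uE].
have [u' u'E] := pr0 _ _ q u qs.
have la : linear (fun m : M => a *: m).
  by move=> b m n; rewrite scalerDr !scalerA [a * b]mulrC.
have [mu muE] := linear_exists la; have [mu' [mus mu'E]] := corestrict mu.
have [|e eE] := @lift_inj _ _ _ _ (submod_incl (image_submod mu))
   (f2 t \- (u' \o d0)) (@submod_incl_inj _ _ _).
  move=> x; apply/submod_inclP/imageP.
  have /qE[m mE] : q ((f2 t \- (u' \o d0)) x) = 0.
    rewrite /= linearB /= u'E -uE qqE; exact: subrr.
  by exists m; rewrite muE mE.
(* If that cocycle of [Q] is a coboundary, the bounding cochain can be corrected to one with values
   in [a M]. Writing it as [a *: h], the difference of the given cocycle and [h \o d1] is killed by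
   [a]. *)
have [h hE] := pr1 _ _ mu' e mus.
have hE' x : a *: h x = (y t).2 x - u' (d0 x).
  by rewrite -muE -mu'E hE eE f2E.
have [|c' c'E] := @lift_inj _ _ _ _ k (f1 t \- (h \o d1)) ki.
  move=> x; apply/kE; rewrite /= scalerBr hE' dd linear0 subr0 f1E (yP t).2.
  exact: subrr.
have [|t' t'E] := sE (c' : Hom X2 K).
  move=> x; apply: ki; rewrite c'E /= f1c.
  by rewrite dd' linear0 subrr linear0.
exists t'; rewrite taE beE; apply: (cl_eq clMP (kc t') (f1c t)).
exists (\- h) => x; rewrite -[LHS]/(kk (s t') x - f1 t x) kkE t'E c'E /=.
by rewrite addrAC subrr add0r.
Qed.

End Multiplication.

End Cohomology.

(** * Homology and projective resolutions *)

Section Homology.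
Variable R : comNzRingType.
Implicit Types U V W H M N K Q : lmodType R.

(** Like [is_cohomology], this describes the quotient by a class function on [V] constrained only on
    the kernel of [g], which avoids working in nested submodules and quotients. *)
Definition is_homology U V W (f : {linear U -> V}) (g : {linear V -> W}) H :=
  exists cl : V -> H,
  [/\ forall a v v', g v = 0 -> g v' = 0 -> cl (a *: v + v') = a *: cl v + cl v',
      forall h, exists2 v, g v = 0 & cl v = h &
      forall v, g v = 0 -> (cl v = 0 <-> exists u, f u = v)].

Lemma homologyP U V W (f : {linear U -> V}) (g : {linear V -> W}) :
  is_homology f g (homology f g).
Proof.
pose K := preim_submod (submod_incl (kernel g)) (image_submod f).
have inK v : g v = 0 -> v \in kernel g by move/kernelP.
(* The value 0 outside the kernel of [g] is an arbitrary default. *)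
pose cl v : homology f g :=
  if pselect (g v = 0) is left e then quot_pi K (Submod (inK v e)) else 0.
have clE v (x : submod (kernel g)) : submod_incl _ x = v -> cl v = quot_pi K x.
  move=> xv; have gv : g v = 0 by rewrite -xv; apply/kernelP/submod_incl_in.
  rewrite /cl; case: pselect => // e; congr (quot_pi K _).
  by apply: (@submod_incl_inj _ _ (kernel g)); rewrite xv.
exists cl; split.
- move=> a v v' gv gv'; pose x := Submod (inK v gv); pose x' := Submod (inK v' gv').
  rewrite (clE (a *: v + v') (a *: x + x')) //.
  by rewrite (clE v x) // (clE v' x') // linearP.
- move=> h; have [x <-] := quot_pi_surj h.
  exists (submod_incl _ x); last exact: clE.
  exact/kernelP/submod_incl_in.
- move=> v gv; rewrite (clE v (Submod (inK v gv))) //.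
  by rewrite quot_pi0 preimP; apply: imageP.
Qed.

Lemma is_homology_map U V W (f : {linear U -> V}) (g : {linear V -> W}) H :
  is_homology f g H -> exists q : {linear submod (kernel g) -> H},
    surj q /\ forall x, q x = 0 <-> exists u, f u = submod_incl _ x.
Proof.
move=> [cl [clL clS cl0]].
have kg (x : submod (kernel g)) : g (submod_incl _ x) = 0.
  exact/kernelP/submod_incl_in.
have [q qE] : exists q : {linear submod (kernel g) -> H},
    forall x, q x = cl (submod_incl _ x).
  by apply: linear_exists => a x y; rewrite linearP clL.
exists q; split=> [h|x]; last by rewrite qE cl0.
have [v gv <-] := clS h; have /kernelP/submod_inclP[x <-] := gv.
by exists x.
Qed.

(** A homotopy equivalence seen in a single degree: on cycles only the boundary part of each
    homotopy remains. *)
Lemma is_homology_iso U V W (f : {linear U -> V}) (g : {linear V -> W}) H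
    U' V' W' (f' : {linear U' -> V'}) (g' : {linear V' -> W'}) H'
    (a : {linear V -> V'}) (b : {linear V' -> V}) :
  is_homology f g H -> is_homology f' g' H' ->
  (forall v, g v = 0 -> g' (a v) = 0) -> (forall v, g' v = 0 -> g (b v) = 0) ->
  (forall u, exists u', f' u' = a (f u)) -> (forall u', exists u, f u = b (f' u')) ->
  (forall v, g v = 0 -> exists u, b (a v) = v + f u) ->
  (forall v, g' v = 0 -> exists u, a (b v) = v + f' u) ->
  exists h : {linear H -> H'}, injective h /\ surj h.
Proof.
move=> /is_homology_map[q [qs q0]] /is_homology_map[q' [qs' q0']] ag bg af bf ba ab.
have kg (x : submod (kernel g)) : g (submod_incl _ x) = 0.
  exact/kernelP/submod_incl_in.
have kg' (x : submod (kernel g')) : g' (submod_incl _ x) = 0.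
  exact/kernelP/submod_incl_in.
have [x|a' a'E] := @lift_inj _ _ _ _ (submod_incl (kernel g'))
    (a \o submod_incl (kernel g)) (@submod_incl_inj _ _ _).
  exact/submod_inclP/kernelP/ag.
have [x /q0[u fu]|h hE] := @lift_surj _ _ _ _ q (q' \o a') qs.
  by apply/q0'; have [u' u'E] := af u; exists u'; rewrite u'E fu a'E.
exists h; split.
  apply/lin_injP => y; have [x <-] := qs y; rewrite hE => /q0'[u'].
  rewrite a'E /= => fu'; apply/q0; have [u fu] := bf u'.
  have [w wE] := ba _ (kg x); exists (u - w).
  by rewrite linearB fu fu' wE addrK.
move=> y; have [x <-] := qs' y.
have /kernelP/submod_inclP[z zE] := bg _ (kg' x).
exists (q z); rewrite hE /=; apply/eqP; rewrite -subr_eq0 -linearB.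
apply/eqP/q0'; have [u uE] := ab _ (kg' x); exists u.
have e : submod_incl (kernel g') (a' z) = a (b (submod_incl (kernel g') x)).
  by rewrite a'E -zE.
by rewrite linearB e uE addrAC subrr add0r.
Qed.

(** Kernels and cokernels are given by maps with the right exactness instead of specific submodules
    and quotients, so closure under isomorphism follows. *)
Definition abelian_class (C : lmodType R -> Prop) :=
  [/\ forall V, (forall v : V, v = 0) -> C V,
      forall U V W (i : {linear U -> V}) (p : {linear V -> W}),
        ses i p -> C U -> C W -> C V,
      forall U V K (f : {linear U -> V}) (k : {linear K -> U}), C U -> C V ->
        injective k -> (forall u, f u = 0 <-> exists x, k x = u) -> C K &
      forall U V Q (f : {linear U -> V}) (q : {linear V -> Q}), C U -> C V ->
        surj q -> (forall v, q v = 0 <-> exists u, f u = v) -> C Q].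

Section AbelianClass.
Variable C : lmodType R -> Prop.
Hypothesis abC : abelian_class C.

Lemma class_iso U V (h : {linear U -> V}) : injective h -> surj h -> C U -> C V.
Proof.
case: abC => _ _ _ cok hi hs CU.
apply: (cok U U V \0 h CU CU hs) => v; split=> [|[u <-]]; last by rewrite linear0.
by move=> /(proj2 (lin_injP h) hi) ->; exists 0.
Qed.

Lemma class_homology U V W (f : {linear U -> V}) (g : {linear V -> W}) H :
  (forall u, g (f u) = 0) -> C U -> C V -> C W -> is_homology f g H -> C H.
Proof.
case: abC => _ _ ker cok gf CU CV CW /is_homology_map[q [qs q0]].
have CK : C (submod (kernel g)).
  apply: (ker _ _ _ g (submod_incl (kernel g)) CV CW (@submod_incl_inj _ _ _)).
  by move=> u; rewrite -submod_inclP kernelP.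
have [u|f' f'E] := @lift_inj _ _ _ _ (submod_incl (kernel g)) f (@submod_incl_inj _ _ _).
  exact/submod_inclP/kernelP.
apply: (cok _ _ _ f' q CU CK qs) => x; rewrite q0; split=> -[u uE]; exists u.
  by apply: submod_incl_inj; rewrite f'E.
by rewrite -uE f'E.
Qed.

End AbelianClass.

(* A projective resolution of [Z 0] cut into the short exact sequences
   [Z n.+1 -inc-> P n -cov-> Z n]. *)
Definition is_resolution (Z P : nat -> lmodType R)
    (cov : forall n, {linear P n -> Z n}) (inc : forall n, {linear Z n.+1 -> P n})
    (d : forall n, {linear P n.+1 -> P n}) :=
  [/\ forall n, projective (P n), forall n, ses (inc n) (cov n) &
      forall n x, d n x = inc n (cov n.+1 x)].

Definition chain_map (Z P Z' P' : nat -> lmodType R)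
    (cov : forall n, {linear P n -> Z n}) (inc : forall n, {linear Z n.+1 -> P n})
    (cov' : forall n, {linear P' n -> Z' n})
    (inc' : forall n, {linear Z' n.+1 -> P' n})
    (phi : forall n, {linear Z n -> Z' n}) (f : forall n, {linear P n -> P' n}) :=
  (forall n x, cov' n (f n x) = phi n (cov n x) :> Z' n) /\
  (forall n z, inc' n (phi n.+1 z) = f n (inc n z) :> P' n).

Section Comparison.
Variables (Z P : nat -> lmodType R)
    (cov : forall n, {linear P n -> Z n}) (inc : forall n, {linear Z n.+1 -> P n})
    (d : forall n, {linear P n.+1 -> P n}).
Hypothesis resP : is_resolution cov inc d.
Variables (Z' P' : nat -> lmodType R)
    (cov' : forall n, {linear P' n -> Z' n})
    (inc' : forall n, {linear Z' n.+1 -> P' n})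
    (d' : forall n, {linear P' n.+1 -> P' n}).
Hypothesis resP' : is_resolution cov' inc' d'.

(** One degree at a time: projectivity lifts the map on syzygies to the projective terms, and the
    lift restricts to the next syzygies. *)
Lemma chain_map_exists (phi0 : {linear Z 0%N -> Z' 0%N}) :
  exists (phi : forall n, {linear Z n -> Z' n}) (f : forall n, {linear P n -> P' n}),
    phi 0%N = phi0 /\ chain_map cov inc cov' inc' phi f.
Proof.
have [prP sesP dP] := resP; have [prP' sesP' dP'] := resP'.
have step n (phi : {linear Z n -> Z' n}) :
    exists fp : {linear P n -> P' n} * {linear Z n.+1 -> Z' n.+1},
      (forall x, cov' n (fp.1 x) = phi (cov n x)) /\
      (forall z, inc' n (fp.2 z) = fp.1 (inc n z)).
  have [ii' ps' ex'] := sesP' n.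
  have [f fE] := prP n _ _ (cov' n) (phi \o cov n) ps'.
  have [z|g gE] := @lift_inj _ _ _ _ (inc' n) (f \o inc n) ii'.
    by apply/ex'; rewrite fE /= (ses0 _ (sesP n)) linear0.
  by exists (f, g).
pose phi := nat_rect (fun n => {linear Z n -> Z' n}) phi0
  (fun n p => (sval (cid (step n p))).2).
exists phi, (fun n => (sval (cid (step n (phi n)))).1); split=> //.
by split=> n; case: (svalP (cid (step n (phi n)))).
Qed.

Section Homotopy.
Variables (phi : forall n, {linear Z n -> Z' n}) (f : forall n, {linear P n -> P' n}).
Hypothesis phif : chain_map cov inc cov' inc' phi f.

Lemma chain_mapE n x : d' n (f n.+1 x) = f n (d n x).
Proof.
have [_ _ dP] := resP; have [_ _ dP'] := resP'; have [fc fi] := phif.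
by rewrite dP' dP fc fi.
Qed.

(** A chain map lifting the zero map is null-homotopic. *)
Lemma homotopy_exists : (forall z, phi 0%N z = 0) ->
  exists s : forall n, {linear P n -> P' n.+1},
    (forall x, f 0%N x = d' 0%N (s 0%N x)) /\
    (forall n x, f n.+1 x = d' n.+1 (s n.+1 x) + s n (d n x)).
Proof.
move=> phi0; have [prP sesP dP] := resP; have [prP' sesP' dP'] := resP'.
have [fc fi] := phif.
have factor n (g : {linear P n -> P' n}) : (forall x, cov' n (g x) = 0) ->
    exists s : {linear P n -> P' n.+1}, forall x, inc' n (cov' n.+1 (s x)) = g x.
  move=> g0; have [ii' ps' ex'] := sesP' n; have [_ ps'' _] := sesP' n.+1.
  have [z|h hE] := @lift_inj _ _ _ _ (inc' n) g ii'; first exact/ex'.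
  have [s sE] := prP n _ _ (cov' n.+1) h ps''.
  by exists s => x; rewrite sE hE.
(* The invariant carried through the recursion: it says that [f n.+1 - s n \o d n] is killed by
   [cov' n.+1], so that the next component of the homotopy exists. *)
pose good n (s : {linear P n -> P' n.+1}) :=
  forall z, cov' n.+1 (s (inc n z)) = phi n.+1 z.
have [|s0 s0E] := factor 0%N (f 0%N); first by move=> x; rewrite fc phi0.
have good0 : good 0%N s0.
  by move=> z; have [ii' _ _] := sesP' 0%N; apply: ii'; rewrite s0E fi.
have step n (s : {s : {linear P n -> P' n.+1} | good n s}) :
    exists s' : {s : {linear P n.+1 -> P' n.+2} | good n.+1 s},
      forall x, f n.+1 x = d' n.+1 (sval s' x) + sval s (d n x).
  case: s => s sg /=.
  have [|s' s'E] := factor n.+1 (f n.+1 \- (s \o d n)).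
    by move=> x; rewrite linearB /= fc dP sg subrr.
  have sg' : good n.+1 s'.
    move=> z; have [ii' _ _] := sesP' n.+1; apply: ii'.
    rewrite s'E /= fi dP (ses0 _ (sesP _)) (linear0 (inc n)) (linear0 s).
    exact: subr0.
  by exists (exist _ s' sg') => x; rewrite /= dP' s'E /= subrK.
pose s := nat_rect (fun n => {s : {linear P n -> P' n.+1} | good n s})
  (exist _ s0 good0) (fun n s => sval (cid (step n s))).
exists (fun n => sval (s n)); split=> [x|n x]; first by rewrite /= dP' s0E.
exact: (svalP (cid (step n (s n)))).
Qed.

End Homotopy.
End Comparison.

(** The isomorphism and its inverse lift to chain maps; their composites minus the identity lift
    zero, hence are null-homotopic. *)
Lemma homotopy_equivalence
    (Z P : nat -> lmodType R) (cov : forall n, {linear P n -> Z n})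
    (inc : forall n, {linear Z n.+1 -> P n}) (d : forall n, {linear P n.+1 -> P n})
    (Z' P' : nat -> lmodType R) (cov' : forall n, {linear P' n -> Z' n})
    (inc' : forall n, {linear Z' n.+1 -> P' n})
    (d' : forall n, {linear P' n.+1 -> P' n})
    (e : {linear Z 0%N -> Z' 0%N}) (e' : {linear Z' 0%N -> Z 0%N}) :
  is_resolution cov inc d -> is_resolution cov' inc' d' ->
  cancel e e' -> cancel e' e ->
  exists (f : forall n, {linear P n -> P' n}) (g : forall n, {linear P' n -> P n})
    (s : forall n, {linear P n -> P n.+1}) (s' : forall n, {linear P' n -> P' n.+1}),
  [/\ (forall n x, d' n (f n.+1 x) = f n (d n x)) /\
      (forall n x, d n (g n.+1 x) = g n (d' n x)),
      forall x, g 0%N (f 0%N x) = x + d 0%N (s 0%N x),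
      forall n x, g n.+1 (f n.+1 x) = x + (d n.+1 (s n.+1 x) + s n (d n x)),
      forall x, f 0%N (g 0%N x) = x + d' 0%N (s' 0%N x) &
      forall n x, f n.+1 (g n.+1 x) = x + (d' n.+1 (s' n.+1 x) + s' n (d' n x))].
Proof.
move=> resP resP' ee' e'e.
have [phi [f [phi0 phif]]] := chain_map_exists resP resP' e.
have [psi [g [psi0 psig]]] := chain_map_exists resP' resP e'.
have [|z|s [s0 sS]] := @homotopy_exists _ _ _ _ _ resP _ _ _ _ _ resP
  (fun n => (psi n \o phi n) \- idfun) (fun n => (g n \o f n) \- idfun).
- case: phif psig => [fc fi] [gc gi]; split=> n x /=.
    by rewrite linearB gc fc.
  by rewrite linearB gi fi.
- by rewrite /= phi0 psi0 ee' subrr.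
have [|z|s' [s'0 s'S]] := @homotopy_exists _ _ _ _ _ resP' _ _ _ _ _ resP'
  (fun n => (phi n \o psi n) \- idfun) (fun n => (f n \o g n) \- idfun).
- case: phif psig => [fc fi] [gc gi]; split=> n x /=.
    by rewrite linearB fc gc.
  by rewrite linearB fi gi.
- by rewrite /= phi0 psi0 e'e subrr.
exists f, g, s, s'; split.
- by split; [exact: (chain_mapE resP resP' phif)|exact: (chain_mapE resP' resP psig)].
- by move=> x; rewrite -s0 /= addrC subrK.
- by move=> n x; rewrite -sS /= addrC subrK.
- by move=> x; rewrite -s'0 /= addrC subrK.
- by move=> n x; rewrite -s'S /= addrC subrK.
Qed.

End Homology.

(** * Ext and Tor in abelian classes of modules *)

Section Resolutions.
Variable R : comNzRingType.
Implicit Types U V W H M N : lmodType R.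

Lemma res_resolution N : is_resolution (fun n => free_cover (syz N n))
  (fun n => submod_incl (kernel (free_cover (syz N n)))) (res_d N).
Proof.
split=> // [n|n]; first exact: free_projective.
exact/ses_kernel/free_cover_surj.
Qed.

Lemma free_mod_fg n : fin_gen (free_mod R 'I_n).
Proof.
apply/fin_genP; exists (map (fun k : 'I_n => free_gen R k) (enum 'I_n)) => x.
have cW := conj (lc0 (map (fun k : 'I_n => free_gen R k) (enum 'I_n)))
  (@lcP _ _ (map (fun k : 'I_n => free_gen R k) (enum 'I_n))).
pose W := prop_submod cW; apply/(mem_prop_submod cW).
(* The projection modulo the span [W] of the generators vanishes on each of them, hence
   everywhere. *)
suff /quot_pi0 : quot_pi W x = 0 by [].
apply: (free_hom_ext (f := quot_pi W) (g := \0)) => k.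
apply/quot_pi0/mem_prop_submod/lc_mem.
by rewrite map_f // mem_enum.
Qed.

Section FinFree.
Hypothesis noethR : noetherian R.

Lemma fg_cover_exists (N : {N : lmodType R | fin_gen N}) :
  exists c : {n : nat & {linear free_mod R 'I_n -> sval N}}, surj (projT2 c).
Proof.
case: N => N [s sN] /=.
exists (existT (fun n => {linear free_mod R 'I_n -> N}) (size s)
  (free_lift (fun i : 'I_(size s) => s`_i))) => v /=.
have [c ->] := sN v; exists (\sum_(i < size s) c i *: free_gen R i).
rewrite linear_sum; apply: eq_bigr => i _.
by rewrite linearZ /= free_lift_gen.
Qed.

Definition fg_rank (N : {N : lmodType R | fin_gen N}) :=
  projT1 (sval (cid (fg_cover_exists N))).
Definition fg_cover (N : {N : lmodType R | fin_gen N}) :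
    {linear free_mod R 'I_(fg_rank N) -> sval N} :=
  projT2 (sval (cid (fg_cover_exists N))).

Definition fg_syzygy (N : {N : lmodType R | fin_gen N}) :
    {N : lmodType R | fin_gen N} :=
  exist _ (submod (kernel (fg_cover N)) : lmodType R)
    (fg_submod noethR (kernel (fg_cover N)) (free_mod_fg _)).

(** Over a Noetherian ring the syzygies stay finitely generated, so choosing finite free covers can
    be iterated. The inverse maps [e] and [e'] stand for the identification of [Z 0] with [N], which
    would otherwise be an equality of modules. *)
Lemma fg_resolution_exists N : fin_gen N ->
  exists (r : nat -> nat) (Z : nat -> lmodType R)
    (cov : forall n, {linear free_mod R 'I_(r n) -> Z n})
    (inc : forall n, {linear Z n.+1 -> free_mod R 'I_(r n)})
    (d : forall n, {linear free_mod R 'I_(r n.+1) -> free_mod R 'I_(r n)})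
    (e : {linear N -> Z 0%N}) (e' : {linear Z 0%N -> N}),
  [/\ @is_resolution R Z (fun n => free_mod R 'I_(r n)) cov inc d,
      cancel e e' & cancel e' e].
Proof.
move=> fgN; pose S n := iter n fg_syzygy (exist _ N fgN).
exists (fun n => fg_rank (S n)), (fun n => sval (S n)), (fun n => fg_cover (S n)).
exists (fun n => submod_incl (kernel (fg_cover (S n)))).
exists (fun n => submod_incl (kernel (fg_cover (S n))) \o fg_cover (S n.+1)).
exists idfun, idfun; split=> //; split=> // n; first exact: free_projective.
apply/ses_kernel; exact: (svalP (cid (fg_cover_exists (S n)))).
Qed.

End FinFree.

Lemma free_linear_exists (K : choiceType) V (f : K -> V) :
  exists l : {linear free_mod R K -> V}, forall k, l (free_gen R k) = f k.
Proof. by exists (free_lift f) => k; apply: free_lift_gen. Qed.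

(** The splitting of [R^(n+1)] as [R^n] plus the line of the first generator: inclusion, retraction
    and coordinate. It drives the inductions on the rank for Hom and for the tensor product. *)
Lemma ord_split n : exists (j : {linear free_mod R 'I_n -> free_mod R 'I_n.+1})
    (r : {linear free_mod R 'I_n.+1 -> free_mod R 'I_n})
    (l : {linear free_mod R 'I_n.+1 -> R^o}),
  [/\ forall x, r (j x) = x, forall x, l (j x) = 0,
      l (free_gen R ord0) = 1 &
      forall x, x = j (r x) + (l x : R) *: free_gen R ord0].
Proof.
have [j jE] := free_linear_exists (fun i : 'I_n => free_gen R (lift ord0 i)).
have [r rE] := free_linear_exists (fun i : 'I_n.+1 =>
  if unlift ord0 i is Some k then free_gen R k else 0 : free_mod R 'I_n).
have [l lE] := @free_linear_exists _ R^o (fun i : 'I_n.+1 => (i == ord0)%:R).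
exists j, r, l; split=> [x|x||x]; last 1 first.
- have lf : linear (fun x => (l x : R) *: free_gen R ord0 : free_mod R 'I_n.+1).
    by move=> a u v; rewrite (linearP l) scalerDl -scalerA.
  have [f fE] := linear_exists lf; rewrite -fE.
  apply: (free_hom_ext (f := idfun) (g := (j \o r) \+ f)) => k /=.
  rewrite fE rE lE; case: unliftP => [i|] ->; last first.
    by rewrite linear0 add0r eqxx scale1r.
  by rewrite jE scale0r addr0.
- apply: (free_hom_ext (f := r \o j) (g := idfun)) => k /=.
  by rewrite jE rE liftK.
- apply: (free_hom_ext (f := l \o j) (g := \0)) => k /=.
  by rewrite jE lE.
by rewrite lE eqxx.
Qed.

Lemma free0 (x : free_mod R 'I_0) : x = 0.
Proof. by apply: (free_hom_ext (f := idfun) (g := \0)) => -[]. Qed.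

End Resolutions.

Section Ext.
Variable R : comNzRingType.
Hypothesis noethR : noetherian R.
Variable C : lmodType R -> Prop.
Hypothesis abC : abelian_class C.
Variables (M N : lmodType R).
Hypotheses (CM : C M) (fgN : fin_gen N).

(** By [ord_split], [Hom(R^(n+1), M)] is an extension of [M], by evaluation at the first generator,
    by [Hom(R^n, M)]. *)
Lemma class_hom n : C (Hom (free_mod R 'I_n) M).
Proof.
case: abC => C0 Cext _ _; elim: n => [|n IH].
  by apply: C0 => c; apply: hom_ext => x; rewrite (free0 x) !linear0.
have [j [r [l [rj lj l0 jr]]]] := ord_split R n.
have [ev evE] : exists ev : {linear Hom (free_mod R 'I_n.+1) M -> M},
    forall c, ev c = (c : {linear _ -> _}) (free_gen R ord0).
  exact: linear_exists.
apply: (Cext _ _ _ (precomp M r) ev) IH CM; split.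
- move=> c c' e; apply: hom_ext => x; rewrite -(rj x).
  exact: (congr1 (fun h : Hom _ M => (h : {linear _ -> _}) (j x)) e).
- move=> m; have lm : linear (fun a : R^o => (a : R) *: m).
    by move=> a u v; rewrite scalerDl -scalerA.
  have [f fE] := linear_exists lm.
  by exists (f \o l : {linear free_mod R 'I_n.+1 -> M}); rewrite evE /= fE l0 scale1r.
move=> c; rewrite evE; split=> [c0|[h <-]].
  exists ((c : {linear _ -> _}) \o j : {linear free_mod R 'I_n -> M}); apply: hom_ext => x.
  rewrite [in RHS](jr x) linearD linearZ /= c0 scaler0 addr0 //.
rewrite /= -[X in h X]addr0.
have -> : r (free_gen R ord0) = 0; last by rewrite addr0 linear0.
have := congr1 r (jr (free_gen R ord0)).
rewrite l0 scale1r linearD rj => /eqP.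
by rewrite -subr_eq0 opprD addrA subrr add0r oppr_eq0 => /eqP.
Qed.

(** [Ext] is defined by a resolution whose terms have infinite rank in general. It is compared with
    a finite free one, for which the complex of Homs, hence its homology, lies in [C]. Degree 0 is
    separate because the incoming map is zero there. *)
Lemma class_Ext i : C (Ext N M i).
Proof.
have [r [Z [cov [inc [d [e [e' [resF ee' e'e]]]]]]]] := fg_resolution_exists noethR fgN.
have [f [g [s [s' [[df dg] gf0 gfS fg0 fgS]]]]] :=
  homotopy_equivalence resF (res_resolution N) e'e ee'.
have dd n x : d n (d n.+1 x) = 0.
  case: resF => _ sesF dF.
  by rewrite !dF (ses0 _ (sesF _)) linear0.
case: i => [|i].
  have CH : C (homology (\0 : {linear Hom (free_mod R 'I_(r 0%N)) M -> _})
                        (precomp M (d 0%N))).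
    apply: (class_homology abC) (homologyP _ _); try exact: class_hom.
    by move=> u; rewrite linear0.
  suff [h [hi hs]] : exists h :
      {linear homology (\0 : {linear Hom (free_mod R 'I_(r 0%N)) M -> _})
                       (precomp M (d 0%N)) -> Ext N M 0}, injective h /\ surj h.
    exact: class_iso abC _ _ h hi hs CH.
  apply: (is_homology_iso (a := precomp M (g 0%N)) (b := precomp M (f 0%N)));
    try exact: homologyP.
  + move=> v v0; apply: hom_ext => x.
    rewrite -[LHS]/((v : {linear _ -> _}) (g 0%N (res_d N 0%N x))) -dg.
    exact: (congr1 (fun h : Hom _ M => (h : {linear _ -> _}) (g 1%N x)) v0).
  + move=> v v0; apply: hom_ext => x.
    rewrite -[LHS]/((v : {linear _ -> _}) (f 0%N (d 0%N x))) -df.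
    exact: (congr1 (fun h : Hom _ M => (h : {linear _ -> _}) (f 1%N x)) v0).
  + by move=> u; exists 0; rewrite !linear0.
  + by move=> u; exists 0; rewrite !linear0.
  + move=> v v0; exists 0; rewrite linear0 addr0; apply: hom_ext => x.
    rewrite -[LHS]/((v : {linear _ -> _}) (g 0%N (f 0%N x))) gf0 linearD.
    rewrite -[RHS]addr0; congr (_ + _).
    exact: (congr1 (fun h : Hom _ M => (h : {linear _ -> _}) (s 0%N x)) v0).
  + move=> v v0; exists 0; rewrite linear0 addr0; apply: hom_ext => x.
    rewrite -[LHS]/((v : {linear _ -> _}) (f 0%N (g 0%N x))) fg0 linearD.
    rewrite -[RHS]addr0; congr (_ + _).
    exact: (congr1 (fun h : Hom _ M => (h : {linear _ -> _}) (s' 0%N x)) v0).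
have CH : C (homology (precomp M (d i)) (precomp M (d i.+1))).
  apply: (class_homology abC) (homologyP _ _); try exact: class_hom.
  by move=> u; apply: hom_ext => x; rewrite /= dd linear0.
suff [h [hi hs]] : exists h : {linear homology (precomp M (d i)) (precomp M (d i.+1))
     -> Ext N M i.+1}, injective h /\ surj h.
  exact: class_iso abC _ _ h hi hs CH.
apply: (is_homology_iso (a := precomp M (g i.+1)) (b := precomp M (f i.+1)));
  try exact: homologyP.
- move=> v v0; apply: hom_ext => x.
  rewrite -[LHS]/((v : {linear _ -> _}) (g i.+1 (res_d N i.+1 x))) -dg.
  exact: (congr1 (fun h : Hom _ M => (h : {linear _ -> _}) (g i.+2 x)) v0).
- move=> v v0; apply: hom_ext => x.
  rewrite -[LHS]/((v : {linear _ -> _}) (f i.+1 (d i.+1 x))) -df.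
  exact: (congr1 (fun h : Hom _ M => (h : {linear _ -> _}) (f i.+2 x)) v0).
- move=> u; exists (precomp M (g i) u); apply: hom_ext => x.
  by rewrite -[LHS]/((u : {linear _ -> _}) (g i (res_d N i x))) -dg.
- move=> u; exists (precomp M (f i) u); apply: hom_ext => x.
  by rewrite -[LHS]/((u : {linear _ -> _}) (f i (d i x))) -df.
- move=> v v0; exists (precomp M (s i) v); apply: hom_ext => x.
  rewrite -[LHS]/((v : {linear _ -> _}) (g i.+1 (f i.+1 x))) gfS 2!linearD.
  congr (_ + _); rewrite -[RHS]add0r; congr (_ + _).
  exact: (congr1 (fun h : Hom _ M => (h : {linear _ -> _}) (s i.+1 x)) v0).
- move=> v v0; exists (precomp M (s' i) v); apply: hom_ext => x.
  rewrite -[LHS]/((v : {linear _ -> _}) (f i.+1 (g i.+1 x))) fgS 2!linearD.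
  congr (_ + _); rewrite -[RHS]add0r; congr (_ + _).
  exact: (congr1 (fun h : Hom _ M => (h : {linear _ -> _}) (s' i.+1 x)) v0).
Qed.

End Ext.

(** * Tensor products with finite free modules, and Tor *)

Section TensorFunctor.
Variables (R : comNzRingType) (M : lmodType R).

(* [tensor_mod] is only used through this interface, as unification problems
   about its nested quotients are intractable. *)
Record tensor_functor := TensorFunctor {
  tobj : lmodType R -> lmodType R;
  tns : forall U : lmodType R, U -> M -> tobj U;
  tmap : forall U V : lmodType R, {linear U -> V} -> {linear tobj U -> tobj V};
  tnsDl : forall (U : lmodType R) (u v : U) m, tns (u + v) m = tns u m + tns v m;
  tnsDr : forall (U : lmodType R) (u : U) m n, tns u (m + n) = tns u m + tns u n;
  tnsZl : forall (U : lmodType R) a (u : U) m, tns (a *: u) m = a *: tns u m;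
  tnsZr : forall (U : lmodType R) a (u : U) m, tns u (a *: m) = a *: tns u m;
  tmapE : forall (U V : lmodType R) (f : {linear U -> V}) u m,
    tmap f (tns u m) = tns (f u) m;
  tns_ext : forall (U W : lmodType R) (f g : {linear tobj U -> W}),
    (forall u m, f (tns u m) = g (tns u m)) -> f =1 g;
  teval_exists : forall (U : lmodType R) (l : {linear U -> R^o}),
    exists ev : {linear tobj U -> M}, forall u m, ev (tns u m) = (l u : R) *: m }.

Lemma tensor_mod_ext (U W : lmodType R) (f g : {linear tensor_mod M U -> W}) :
  (forall u m, f (tensor u m) = g (tensor u m)) -> f =1 g.
Proof.
move=> fg t; have [x <-] := quot_pi_surj t.
pose q := quot_pi (span_submod (@bilin_rel R M U)).
apply: (free_hom_ext (f := f \o q) (g := g \o q)) => -[u m].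
exact: fg.
Qed.

Lemma tensor_mod_eval (U : lmodType R) (l : {linear U -> R^o}) :
  exists ev : {linear tensor_mod M U -> M}, forall u m, ev (tensor u m) = (l u : R) *: m.
Proof.
have [h hE] := free_linear_exists (fun um : U * M => (l um.1 : R) *: um.2).
pose q := quot_pi (span_submod (@bilin_rel R M U)).
have [x|ev evE] := @lift_surj _ _ _ _ q h (@quot_pi_surj _ _ _).
  move=> /quot_pi0/asboolP/(_ (kernel h)) H; apply/kernelP; apply: H => {}x.
  case=> *; apply/kernelP.
  - rewrite linearB linearD !hE /= linearD scalerDl; exact: subrr.
  - rewrite linearB linearD !hE /= scalerDr; exact: subrr.
  - rewrite linearB linearZ !hE /= linearZ scalerA; exact: subrr.
  - rewrite linearB linearZ !hE /= !scalerA mulrC; exact: subrr.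
by exists ev => u m; rewrite [LHS]evE hE.
Qed.

Definition tensor_map_linear (U V : lmodType R) (f : {linear U -> V}) :
  {linear tensor_mod M U -> tensor_mod M V} := tensor_map M f.

Definition tensor_mod_functor : tensor_functor :=
  @TensorFunctor (fun U => tensor_mod M U) (@tensor R M) tensor_map_linear
    (@tensorDl R M) (@tensorDr R M) (@tensorZl R M) (@tensorZr R M)
    (@tensor_mapE R M) tensor_mod_ext tensor_mod_eval.

Section Properties.
Variable T : tensor_functor.
Implicit Types U V W : lmodType R.

Lemma tmap_eq U V (f g : {linear U -> V}) :
  (forall u, f u = g u) -> forall t, tmap T f t = tmap T g t.
Proof. by move=> fg; apply: tns_ext => u m; rewrite !tmapE fg. Qed.

Lemma tmap_id U t : tmap T (idfun : {linear U -> U}) t = t.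
Proof. by apply: (tns_ext (g := idfun)) => u m; rewrite tmapE. Qed.

Lemma tmap_comp U V W (g : {linear V -> W}) (f : {linear U -> V}) t :
  tmap T (g \o f) t = tmap T g (tmap T f t).
Proof.
by apply: (tns_ext (g := tmap T g \o tmap T f)) => u m; rewrite /= !tmapE.
Qed.

Lemma tmapD U V (f g : {linear U -> V}) t :
  tmap T (f \+ g) t = tmap T f t + tmap T g t.
Proof.
apply: (tns_ext (g := tmap T f \+ tmap T g)) => u m.
by rewrite /= !tmapE tnsDl.
Qed.

Lemma tmap0 U V t : tmap T (\0 : {linear U -> V}) t = 0.
Proof.
apply: (tns_ext (g := \0)) => u m; rewrite tmapE /=.
by rewrite -[0 in LHS](scale0r (0 : V)) tnsZl scale0r.
Qed.

Variable C : lmodType R -> Prop.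
Hypotheses (abC : abelian_class C) (CM : C M).

(** Induction on [n]: tensoring [ord_split] with [M] gives an extension of [M] by the tensor product
    for the smaller rank. *)
Lemma class_tensor n : C (tobj T (free_mod R 'I_n)).
Proof.
case: abC => C0 Cext _ _; elim: n => [|n IH].
  apply: C0; apply: (tns_ext (f := idfun) (g := \0)) => u m /=.
  by rewrite (free0 u) -[0 in LHS](scale0r 0) tnsZl scale0r.
have [j [r [l [rj lj l0 jr]]]] := ord_split R n.
have [ev evE] := teval_exists T l.
have [sg sgE] : exists sg : {linear M -> tobj T (free_mod R 'I_n.+1)},
    forall m, sg m = tns T (free_gen R ord0) m.
  by apply: linear_exists => a m m'; rewrite tnsDr tnsZr.
have split t : t = tmap T j (tmap T r t) + sg (ev t).
  apply: (tns_ext (f := idfun)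
    (g := (tmap T j \o tmap T r) \+ (sg \o ev))) => u m /=.
  by rewrite !tmapE evE sgE tnsZr -tnsZl -tnsDl -jr.
have evj t : ev (tmap T j t) = 0.
  apply: (tns_ext (f := ev \o tmap T j) (g := \0)) => u m /=.
  by rewrite tmapE evE lj scale0r.
apply: (Cext _ _ _ (tmap T j) ev) IH CM; split.
- apply: (can_inj (g := tmap T r)) => t.
  by rewrite -tmap_comp (@tmap_eq _ _ _ idfun) ?tmap_id.
- by move=> m; exists (sg m); rewrite sgE evE l0 scale1r.
- move=> t; split=> [t0|[t' <-]]; last exact: evj.
  by exists (tmap T r t); rewrite [RHS]split t0 linear0 addr0.
Qed.

End Properties.
End TensorFunctor.

Section Tor.
Variable R : comNzRingType.
Hypothesis noethR : noetherian R.
Variable C : lmodType R -> Prop.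
Hypothesis abC : abelian_class C.
Variables (M N : lmodType R).
Hypotheses (CM : C M) (fgN : fin_gen N).

(** The covariant counterpart of [class_Ext]: the functor preserves the chain maps and the
    homotopies between the given resolution and a finite free one. *)
Lemma class_Tor_functor (T : tensor_functor M) :
  C (homology (tmap T (res_d N 0%N))
      (\0 : {linear tobj T (res N 0) -> tobj T (res N 0)})) /\
  forall i, C (homology (tmap T (res_d N i.+1)) (tmap T (res_d N i))).
Proof.
have [r [Z [cov [inc [d [e [e' [resF ee' e'e]]]]]]]] := fg_resolution_exists noethR fgN.
have [f [g [s [s' [[df dg] gf0 gfS fg0 fgS]]]]] :=
  homotopy_equivalence resF (res_resolution N) e'e ee'.
have dd n x : d n (d n.+1 x) = 0.
  case: resF => _ sesF dF.
  by rewrite !dF (ses0 _ (sesF _)) linear0.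

have Tcomm (U V V' W : lmodType R) (a : {linear U -> V}) (b : {linear V -> W})
    (a' : {linear U -> V'}) (b' : {linear V' -> W}) :
    (forall x, b (a x) = b' (a' x)) ->
    forall t, tmap T b (tmap T a t) = tmap T b' (tmap T a' t).
  by move=> e0 t; rewrite -!tmap_comp; apply: tmap_eq.
have Tdd n t : tmap T (d n) (tmap T (d n.+1) t) = 0.
  rewrite -tmap_comp (@tmap_eq _ _ _ _ _ _ \0) ?tmap0 //.
  exact: dd.
have Th0 (U V U' : lmodType R) (a : {linear U -> V}) (b : {linear V -> U})
    (h : {linear U -> U'}) (k : {linear U' -> U}) :
    (forall x, b (a x) = x + k (h x)) ->
    forall t, tmap T b (tmap T a t) = t + tmap T k (tmap T h t).
  move=> e0 t; rewrite -!tmap_comp -[X in _ = X + _](tmap_id t).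
  by rewrite -tmapD; apply: tmap_eq.
have ThS (U V U' U'' : lmodType R) (a : {linear U -> V}) (b : {linear V -> U})
    (h : {linear U -> U'}) (k : {linear U' -> U}) 
    (h' : {linear U -> U''}) (k' : {linear U'' -> U}) :
    (forall x, b (a x) = x + (k (h x) + k' (h' x))) ->
    forall t, tmap T b (tmap T a t) = t + (tmap T k (tmap T h t) + tmap T k' (tmap T h' t)).
  move=> e0 t; rewrite -!tmap_comp -[X in _ = X + _](tmap_id t).
  by rewrite -!tmapD; apply: tmap_eq.
split=> [|i].
  pose F0 := (\0 : {linear tobj T (free_mod R 'I_(r 0%N)) ->
                     tobj T (free_mod R 'I_(r 0%N))}).
  have CH : C (homology (tmap T (d 0%N)) F0).
    by apply: (class_homology abC) (homologyP _ _) => //; exact: class_tensor.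
  suff [h [hi hs]] : exists h : {linear homology (tmap T (d 0%N)) F0 ->
      homology (tmap T (res_d N 0%N))
        (\0 : {linear tobj T (res N 0) -> tobj T (res N 0)})},
      injective h /\ surj h by exact: class_iso abC _ _ h hi hs CH.
  apply: (is_homology_iso (a := tmap T (f 0%N)) (b := tmap T (g 0%N)));
    try exact: homologyP.
  + by move=> t _.
  + by move=> t _.
  + by move=> t; exists (tmap T (f 1%N) t); apply: Tcomm.
  + by move=> t; exists (tmap T (g 1%N) t); apply: Tcomm.
  + by move=> t _; exists (tmap T (s 0%N) t); apply: Th0.
  + by move=> t _; exists (tmap T (s' 0%N) t); apply: Th0.
have CH : C (homology (tmap T (d i.+1)) (tmap T (d i))).
  by apply: (class_homology abC) (homologyP _ _) => //; exact: class_tensor.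
suff [h [hi hs]] : exists h : {linear homology (tmap T (d i.+1)) (tmap T (d i)) ->
      homology (tmap T (res_d N i.+1)) (tmap T (res_d N i))},
    injective h /\ surj h by exact: class_iso abC _ _ h hi hs CH.
apply: (is_homology_iso (a := tmap T (f i.+1)) (b := tmap T (g i.+1)));
  try exact: homologyP.
- by move=> t t0; rewrite -[LHS](Tcomm _ _ _ _ (d i) (f i)) ?t0 ?linear0.
- by move=> t t0; rewrite -[LHS](Tcomm _ _ _ _ (res_d N i) (g i)) ?t0 ?linear0.
- by move=> t; exists (tmap T (f i.+2) t); apply: Tcomm.
- by move=> t; exists (tmap T (g i.+2) t); apply: Tcomm.
- move=> t t0; exists (tmap T (s i.+1) t).
  by rewrite (ThS _ _ _ _ _ _ _ _ _ _ (gfS i)) t0 linear0 addr0.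
- move=> t t0; exists (tmap T (s' i.+1) t).
  by rewrite (ThS _ _ _ _ _ _ _ _ _ _ (fgS i)) t0 linear0 addr0.
Qed.

Lemma class_Tor i : C (Tor N M i).
Proof.
have [T0 TS] := class_Tor_functor (tensor_mod_functor M).
by case: i.
Qed.

End Tor.

(** * Supports and dimension *)

Section Primes.
Variable R : comNzRingType.
Implicit Types (p q : prime_idealr R) (T V M : lmodType R).

Section MakePrime.
Variable P : R -> Prop.

Definition prime_closed := [/\ P 0, ~ P 1, forall a u v, P u -> P v -> P (a * u + v) &
  forall u v, P (u * v) -> P u \/ P v].

Definition prime_pred & prime_closed : R -> bool := fun x => `[< P x >].

Hypothesis Pp : prime_closed.

Fact prime_pred_idealr : idealr_closed (prime_pred Pp).
Proof.
have [P0 P1 Pl _] := Pp; split; first exact/asboolP.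
  by apply/negP => /asboolP.
by move=> a u v /asboolP Pu /asboolP Pv; apply/asboolP/Pl.
Qed.

Fact prime_pred_prime : prime_idealr_closed (prime_pred Pp).
Proof.
have [_ _ _ Pm] := Pp; move=> u v /asboolP/Pm[]/asboolP uP; apply/orP; [left|right]; exact: uP.
Qed.

HB.instance Definition _ := isIdealr.Build R (prime_pred Pp) prime_pred_idealr.
HB.instance Definition _ := isPrimeIdealrClosed.Build R (prime_pred Pp) prime_pred_prime.

Lemma prime_exists : exists p : prime_idealr R, forall x, x \in p <-> P x.
Proof.
exists (PrimeIdealr.clone R (prime_pred Pp) _) => x.
by split=> [/asboolP|?] //; apply/asboolP.
Qed.

End MakePrime.

(** Replaces localizations by annihilators: a fraction with numerator [t] is nonzero exactly when no
    element outside [p] kills [t]. *)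
Lemma suppP T p : supp T p <-> exists t : T, forall r : R, r *: t = 0 -> r \in p.
Proof.
split=> [[x nx]|[t tp]].
  case E: (repr x) => [t s]; exists t => r rt; apply: contrapT => /negP rp.
  apply: nx; rewrite -[x]reprK E /loc0 /frac; apply/eqmodP/asboolP.
  by exists r => //=; rewrite scaler0 subr0 scalerA mulrC -scalerA rt scaler0.
exists (frac t (exist _ 1 (one_denom p))) => /eqmodP/asboolP[u up /=].
by rewrite scaler0 subr0 scale1r => /tp; apply/negP.
Qed.

Definition supp_in (Q : prime_idealr R -> Prop) T := forall p, supp T p -> Q p.

Lemma supp_in_inj Q T V (f : {linear T -> V}) :
  injective f -> supp_in Q V -> supp_in Q T.
Proof.
move=> fi QV p /suppP[t tp]; apply/QV/suppP; exists (f t) => r.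
by rewrite -linearZ => /(proj2 (lin_injP f) fi)/tp.
Qed.

Lemma supp_in_surj Q T V (f : {linear T -> V}) :
  surj f -> supp_in Q T -> supp_in Q V.
Proof.
move=> fs QT p /suppP[v vp]; have [t tv] := fs v.
apply/QT/suppP; exists t => r rt; apply: vp; rewrite -tv -linearZ rt.
exact: linear0.
Qed.

(** Either the annihilator of [f v] lies in [p], or some [r] outside [p] kills [f v]; then [r *: v]
    comes from [T], and its annihilator lies in [p]. *)
Lemma supp_in_ext Q T V M (i : {linear T -> V}) (f : {linear V -> M}) :
  ses i f -> supp_in Q T -> supp_in Q M -> supp_in Q V.
Proof.
move=> [ii fs ex] QT QM p /suppP[v vp].
have [H|/existsNP[r /not_implyP[rv /negP rp]]] :=
  pselect (forall r : R, r *: f v = 0 -> r \in p).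
  by apply/QM/suppP; exists (f v).
have [|t tE] := proj1 (ex (r *: v)); first by rewrite linearZ.
apply/QT/suppP; exists t => s st.
have := vp (s * r); rewrite prime_idealrM (negbTE rp) orbF; apply.
by rewrite -scalerA -tE -linearZ st linear0.
Qed.

Section NoetherianPrimes.
Hypothesis noethR : noetherian R.

Lemma fg_regular : fin_gen (R^o : lmodType R).
Proof.
apply/fin_genP; exists [:: (1 : R^o)] => v /=; exists v.
by rewrite [_ *: _]mulr1 subrr.
Qed.

(** An ideal maximal among those that contain the annihilator of [t] and no power of [a] is
    prime. *)
Lemma prime_avoiding T (t : T) (a : R) : (forall k, a ^+ k *: t <> 0) ->
  exists p, (forall r : R, r *: t = 0 -> r \in p) /\ a \notin p.
Proof.
move=> at0; have lt : linear (fun r : R^o => (r : R) *: t).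
  by move=> b u v; rewrite scalerDl -scalerA.
have [f fE] := linear_exists lt.
have [|W [WP fW Wmax]] := noeth_max noethR
    (P := fun W : submodClosed R^o => forall k, (a ^+ k : R^o) \notin W)
    (W0 := kernel f) fg_regular.
  by move=> k; apply/negP => /kernelP; rewrite fE => /at0.
(* By maximality, the ideal generated by [W] and [u] contains a power of [a]. *)
have grow (u : R) : u \notin W -> exists k (r : R), (a ^+ k - r * u : R^o) \in W.
  move=> uW; apply: contrapT => no; move/negP: uW; apply.
  pose Q (x : R^o) := exists r : R, (x - r * u : R^o) \in W.
  have cQ : Q 0 /\ forall (b : R) x y, Q x -> Q y -> Q (b *: x + y).
    split=> [|b x y [r rW] [s sW]]; first by exists 0; rewrite mul0r subrr rpred0.
    exists (b * r + s).
    have e : b * ((x : R) - r * u) + ((y : R) - s * u) =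
      b * (x : R) + (y : R) - (b * r + s) * u by ring.
    exact: (eq_ind _ (fun z : R^o => z \in W) (rpredD (rpredZ b rW) sW) _ e).
  apply: (Wmax (@prop_submod R R^o Q cQ)).
  - move=> k; apply/negP => /mem_prop_submod[r rW]; apply: no.
    by exists k, r.
  - by move=> v vW; apply/mem_prop_submod; exists 0; rewrite mul0r subr0.
  - by apply/mem_prop_submod; exists 1; rewrite mul1r subrr rpred0.
have [|p pE] := @prime_exists (fun x : R => (x : R^o) \in W).
  split; first exact: rpred0.
  - by apply/negP; rewrite -(expr0 a).
  - by move=> b u v uW vW; rewrite rpredD // (rpredZ (b : R)).
  move=> u v uvW; apply: contrapT => /not_orP[/negP uW /negP vW].
  have [k [r kW]] := grow u uW; have [l [s lW]] := grow v vW.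
  move/negP: (WP (k + l)%N); apply.
  (* If [u * v] is in [W], multiplying the two relations puts [a ^+ (k + l)] in [W]. *)
  have e : a ^+ l * (a ^+ k - r * u) +
     (r * u * (a ^+ l - s * v) + r * s * (u * v)) = a ^+ (k + l).
    by rewrite exprD; ring.
  exact: (eq_ind _ (fun z : R^o => z \in W) (rpredD (rpredZ (a ^+ l) kW)
    (rpredD (rpredZ (r * u) lW) (rpredZ (r * s) uvW))) _ e).
exists p; split=> [r rt|]; first by apply/pE/fW/kernelP; rewrite fE.
by apply/negP => /pE; apply/negP; rewrite -(expr1 a).
Qed.

Lemma supp_nilpotent T (a : R) : supp_in (fun p => a \in p) T ->
  forall t : T, exists k, a ^+ k *: t = 0.
Proof.
move=> sT t; apply: contrapT => /forallNP/(prime_avoiding (t := t))[p [tp /negP]].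
by apply; apply/sT/suppP; exists t.
Qed.

Lemma supp_empty T : supp_in (fun=> False) T -> forall t : T, t = 0.
Proof.
move=> sT t; have [k] := supp_nilpotent (a := 1) (fun p sp => False_ind _ (sT p sp)) t.
by rewrite expr1n scale1r.
Qed.

(** An associated prime of [M / W]: a maximal annihilator among the nonzero multiples of [v] modulo
    [W] is prime. *)
Lemma assoc_prime M (W : submodClosed M) (v : M) : v \notin W ->
  exists (r : R) p, forall s : R, s \in p <-> s *: (r *: v) \in W.
Proof.
move=> vW.
pose Q (J : submodClosed R^o) := exists2 r : R, r *: v \notin W &
  forall s : R, (s : R^o) \in J <-> s *: (r *: v) \in W.
have cJ (r : R) : (0 : R) *: (r *: v) \in W /\ forall (a : R) (b c : R^o),
    (b : R) *: (r *: v) \in W -> (c : R) *: (r *: v) \in W ->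
    (a *: b + c : R) *: (r *: v) \in W.
  split=> [|a b c bW cW]; first by rewrite scale0r rpred0.
  by rewrite scalerDl -[(a *: b : R^o)]/(a * b) -[X in X + _]scalerA rpredD // rpredZ.
pose J r := @prop_submod R R^o _ (cJ r).
have QJ r : r *: v \notin W -> Q (J r).
  by move=> rW; exists r => // s; apply: mem_prop_submod.
have [|W' [[r rW JE] _ Jmax]] := noeth_max noethR (P := Q) (W0 := J 1) fg_regular.
  by apply: QJ; rewrite scale1r.
exists r; apply: prime_exists; split.
- by rewrite scale0r rpred0.
- by rewrite scale1r; apply/negP.
- by move=> a b c bW cW; rewrite scalerDl -scalerA rpredD // rpredZ.
move=> a b abW; have [bW|/negP bW] := pselect (b *: (r *: v) \in W); [by right|left].
apply/JE/(Jmax (J (b * r))).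
- by apply: QJ; rewrite -scalerA.
- move=> s /JE sW; apply/mem_prop_submod.
  by rewrite scalerA mulrCA -!scalerA rpredZ.
- by apply/mem_prop_submod; move: abW; rewrite !scalerA mulrA.
Qed.

End NoetherianPrimes.

(* [dim R/p < e] *)
Fixpoint coht_lt (e : nat) p : Prop :=
  if e is e'.+1 then forall q, prime_lt p q -> coht_lt e' q else False.

End Primes.

(** * Modules that are Artinian away from a set of primes *)

Section ArtinianModulo.
Variables (R : comNzRingType) (G : prime_idealr R -> Prop).
Implicit Types (p q : prime_idealr R) (M K : lmodType R).

(* Descending chains of submodules of [M] meeting [W] become stationary after
   localization at the primes outside [G], uniformly in the prime. *)
Definition artinian_on M (W : submodClosed M) :=
  forall N : nat -> submodClosed M, (forall n y, y \in N n.+1 -> y \in N n) ->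
  exists k0, forall k, (k0 <= k)%N -> forall y, y \in N k0 -> y \in W ->
    forall p, ~ G p -> exists2 r, r \notin p & r *: y \in N k.

Definition artinian_mod M :=
  forall N : nat -> submodClosed M, (forall n y, y \in N n.+1 -> y \in N n) ->
  exists k0, forall k, (k0 <= k)%N -> forall y, y \in N k0 ->
    forall p, ~ G p -> exists2 r, r \notin p & r *: y \in N k.

Lemma chain_le M (N : nat -> submodClosed M) :
  (forall n y, y \in N n.+1 -> y \in N n) ->
  forall m n y, (m <= n)%N -> y \in N n -> y \in N m.
Proof.
move=> Nd m n y /subnK <-; elim: (n - m)%N => //= k IH.
by rewrite addSn => /Nd.
Qed.

Hypothesis noethR : noetherian R.

(** Noetherian induction: if a maximal [W] with the property were proper, it could be enlarged by an
    element [y] whose annihilator modulo [W] is a prime [p]. The added factor is a copy of [R/p],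
    whose nonzero submodules become everything at the primes outside [G]. *)
Lemma artinian_fg M : fin_gen M ->
  (forall p, supp M p -> forall q, prime_lt p q -> G q) -> artinian_mod M.
Proof.
move=> fgM sM.
have c0 : (0 : M) = 0 /\ forall (a : R) (u v : M), u = 0 -> v = 0 -> a *: u + v = 0.
  by split=> // a u v -> ->; rewrite scaler0 addr0.
pose W0 := @prop_submod _ M (fun v => v = 0) c0.
have [|W [aW _ Wmax]] := noeth_max noethR (P := @artinian_on M) (W0 := W0) fgM.
  move=> N Nd; exists 0%N => k _ y _ /mem_prop_submod -> p _.
  by exists 1; rewrite ?idealr1 // scaler0 rpred0.
suff fullW v : v \in W.
  move=> N Nd; have [k0 k0P] := aW N Nd; exists k0 => k kk y yN p Gp.
  exact: k0P (fullW y) _ _.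
apply: contrapT => /negP vW; have [r [p pE]] := assoc_prime noethR vW.
set y := r *: v in pE.
have yW : y \notin W.
  by apply/negP; rewrite -[y]scale1r => /pE; rewrite idealr1.
pose Q (z : M) := exists c : R, z - c *: y \in W.
have cQ : Q 0 /\ forall (a : R) u w, Q u -> Q w -> Q (a *: u + w).
  split=> [|a u w [c cW] [d dW]]; first by exists 0; rewrite scale0r subrr rpred0.
  exists (a * c + d); rewrite scalerDl -scalerA opprD addrACA -scalerBr.
  by rewrite rpredD ?rpredZ.
move/negP: yW; apply.
apply: (Wmax (prop_submod cQ)); first last.
- by apply/mem_prop_submod; exists 1; rewrite scale1r subrr rpred0.
- by move=> z zW; apply/mem_prop_submod; exists 0; rewrite scale0r subr0.
move=> N Nd; have [k1 k1P] := aW N Nd.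
(* The ideals [A k], modulo [p], are the traces of the chain on the factor generated by [y]. *)
pose A k (s : R) := exists2 n, n \in N k & s *: y - n \in W.
have NA k z c : z \in N k -> z - c *: y \in W -> A k c.
  move=> zN zW; exists z => //.
  by rewrite -opprB -scaleN1r rpredZ.
(* If some trace is zero, members of the chain meet the enlarged submodule only in [W] from there
   on. *)
have [[k0 k0P]|noA] := pselect (exists k, forall s, A k s -> s \in p).
  exists (maxn k1 k0) => k; rewrite geq_max => /andP[k1k k0k] z zN.
  move=> /mem_prop_submod[c cW] q Gq.
  have z0 : z \in N k0 by apply: (chain_le Nd) zN; rewrite leq_maxr.
  have z1 : z \in N k1 by apply: (chain_le Nd) zN; rewrite leq_maxl.
  have /k0P/pE cyW := NA _ _ _ z0 cW.
  have zW : z \in W by rewrite -[z](subrK (c *: y)) rpredD.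
  exact: k1P zW q Gq.
exists k1 => k k1k z zN /mem_prop_submod[c cW] q Gq.
(* If [p] is contained in [q], an element of [A k] outside [p] cannot lie in [q]: otherwise [q]
   would be strictly larger than [p], hence in [G]. If not, an element of [p] outside [q] sends [y]
   into [W]. *)
have [s [n nN snW] sq] : exists2 s, A k s & s \notin q.
  have [pq|/existsNP[s /not_implyP[sp /negP sq]]] := pselect (forall x, x \in p -> x \in q).
    have /existsNP[s /not_implyP[As sp]] : ~ forall s, A k s -> s \in p.
      by move=> H; apply: noA; exists k.
    exists s => //; apply/negP => sq; apply: Gq; apply: (sM p).
      by apply/suppP; exists y => t ty; apply/pE; rewrite ty rpred0.
    by split=> //; exists s => //; apply/negP.
  by exists s => //; exists 0; rewrite ?rpred0 ?subr0 //; apply/pE.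
(* [s *: z - c *: n] lies in both [W] and [N k1], so the bound for [W] applies to it. *)
have [||r' rq rN] := k1P k k1k (s *: z - c *: n) _ _ q Gq.
- by apply: submodB; rewrite rpredZ //; apply: (chain_le Nd) nN.
- have -> : s *: z - c *: n = s *: (z - c *: y) + c *: (s *: y - n).
    by rewrite !scalerBr !scalerA [c * s]mulrC addrA subrK.
  by rewrite rpredD ?rpredZ.
exists (r' * s); first by rewrite prime_idealrM negb_or rq.
rewrite -scalerA -[s *: z](subrK (c *: n)) scalerDr rpredD //.
by rewrite !rpredZ.
Qed.

(* Melkersson's argument: the filtration of a submodule [N] by the modules
   [a^i (N n (0 :_M a^(i+1)))] of [0 :_M a] determines [N]. *)
Lemma artinian_torsion M K (k : {linear K -> M}) (a : R) :
  injective k -> (forall m, a *: m = 0 <-> exists x, k x = m) ->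
  (forall m : M, exists i, a ^+ i *: m = 0) -> artinian_mod K -> artinian_mod M.
Proof.
move=> ki kE tor artK N Nd.
pose Q i n (w : K) := exists2 m, m \in N n & k w = a ^+ i *: m.
have cQ i n : Q i n 0 /\ forall (b : R) u v, Q i n u -> Q i n v -> Q i n (b *: u + v).
  split=> [|b u v [x xN kx] [y yN ky]]; first by exists 0; rewrite ?rpred0 ?linear0 ?scaler0.
  exists (b *: x + y); first by rewrite rpredD ?rpredZ.
  by rewrite linearP kx ky scalerDr !scalerA mulrC.
pose F i n := prop_submod (cQ i n).
have FE i n w : w \in F i n <-> Q i n w by apply: mem_prop_submod.
have Fn i n w : w \in F i n.+1 -> w \in F i n.
  by move=> /FE[m mN km]; apply/FE; exists m => //; apply: Nd.
have Fi i n w : w \in F i.+1 n -> w \in F i n.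
  move=> /FE[m mN km]; apply/FE; exists (a *: m); first by rewrite rpredZ.
  by rewrite km exprSr scalerA.
have Fni i m n w : (m <= n)%N -> w \in F i n -> w \in F i m.
  exact: (chain_le (N := F i) (Fn i)).
have Fii n i j w : (i <= j)%N -> w \in F j n -> w \in F i n.
  exact: (chain_le (N := F^~ n) (fun i => Fi i n)).
(* The diagonal chain settles all indices from [d] on at once; the finitely many smaller ones have
   their own bounds [e i]. This makes [k0] independent of [i]. *)
have [|d dP] := artK (fun n => F n n); first by move=> n w /Fi/Fn.
have /choice[e eP] i := artK (F i) (Fn i).
pose k0 := maxn d (\max_(i < d) e i).
have stab i l w : (k0 <= l)%N -> w \in F i k0 -> forall p, ~ G p ->
    exists2 r, r \notin p & r *: w \in F i l.
  move=> kl wF p Gp; have [id|di] := ltnP i d.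
    have ek : (e i <= k0)%N.
      by rewrite leq_max; apply/orP; right; apply: (leq_bigmax (Ordinal id)).
    by apply: (eP i l (leq_trans ek kl)) => //; apply: Fni wF.
  have wd : w \in F d d.
    by apply: Fii di _; apply: Fni wF; rewrite leq_maxl.
  have [|r rp rF] := dP (maxn i l) _ w wd p Gp; first by rewrite leq_max di.
  exists r => //; apply: (Fni _ _ (maxn i l)); first by rewrite leq_maxr.
  by apply: Fii rF; rewrite leq_maxl.
exists k0 => l kl y yN p Gp.
(* Induction on the exponent: up to a factor [r] outside [p], [a ^+ i *: y] is [a ^+ i *: m] with
   [m] in [N l], so [r *: y - m] is killed by [a ^+ i]. *)
have [i] := tor y; elim: i y yN => [|i IH] y yN.
  rewrite expr0 scale1r => ->; exists 1; rewrite ?idealr1 //.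
  by rewrite scaler0 rpred0.
move=> iy; have [|w wE] := proj1 (kE (a ^+ i *: y)).
  by rewrite scalerA -exprS.
have [|r rp /FE[m mN km]] := stab i l w kl _ p Gp; first by apply/FE; exists y.
have [||r' rp' rN] := IH (r *: y - m).
- by apply: submodB; [rewrite rpredZ|apply: (chain_le Nd) mN].
- by rewrite scalerBr -km (linearZZ k) wE !scalerA mulrC subrr.
exists (r' * r); first by rewrite prime_idealrM negb_or rp'.
by rewrite -scalerA -[r *: y](subrK m) scalerDr rpredD // rpredZ.
Qed.

Definition killed (xs : seq R) M (m : M) := forall x, x \in xs -> x *: m = 0.

Lemma killed_closed xs M : killed xs (0 : M) /\
  forall a (u v : M), killed xs u -> killed xs v -> killed xs (a *: u + v).
Proof.
split=> [x _|a u v ku kv x xx]; first by rewrite scaler0.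
by rewrite scalerDr scalerA mulrC -scalerA ku // kv // scaler0 addr0.
Qed.

Definition killed_submod xs M := prop_submod (killed_closed xs M).

Lemma mul_linear_exists M (a : R) : exists mu : {linear M -> M}, forall m, mu m = a *: m.
Proof.
by apply: linear_exists => b u v; rewrite scalerDr !scalerA mulrC.
Qed.

(** Induction on [xs] by [artinian_torsion]: passing to the submodule killed by the first element
    removes it from the list, until the finitely generated common kernel remains. *)
Lemma artinian_killed xs M : 
  (forall x, x \in xs -> forall m : M, exists i, x ^+ i *: m = 0) ->
  fin_gen (submod (killed_submod xs M)) ->
  (forall p, supp M p -> forall q, prime_lt p q -> G q) -> artinian_mod M.
Proof.
elim: xs M => [|x xs IH] M tor fgM sM.
  apply: artinian_fg => //; apply: (fg_surj (f := submod_incl (killed_submod [::] M))) fgM.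
  by move=> m; apply/submod_inclP/mem_prop_submod.
have [mu muE] := mul_linear_exists M x.
pose k := submod_incl (kernel mu).
have ki : injective k by exact: submod_incl_inj.
apply: (artinian_torsion (k := k) (a := x) ki).
- by move=> m; rewrite -muE -kernelP submod_inclP.
- by apply: tor; rewrite inE eqxx.
apply: IH.
- move=> z zx m; have [|i iE] := tor z _ (k m); first by rewrite inE zx orbT.
  by exists i; apply: ki; apply: etrans (linearZZ k _ _) _; rewrite iE; exact/esym/linear0.
- have [u|f fE] := @lift_inj _ _ _ _ (submod_incl (killed_submod (x :: xs) M))
    (k \o submod_incl (killed_submod xs _)) (@submod_incl_inj _ _ _).
    apply/submod_inclP/mem_prop_submod => z; rewrite inE => /orP[/eqP->|zx].
      by rewrite -muE; apply/kernelP/submod_incl_in.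
    have /mem_prop_submod/(_ z zx) H := submod_incl_in u.
    apply: etrans (esym (linearZZ k _ _)) _; apply: etrans (congr1 k H) _.
    exact: linear0.
  apply: (fg_inj noethR (f := f)) fgM => u v /(congr1 (submod_incl _)).
  by rewrite !fE => /ki/submod_incl_inj.
exact: (supp_in_inj ki sM).
Qed.

End ArtinianModulo.

(** * Dimension at most one in terms of chains of primes *)

Section Dimension.
Variable R : comNzRingType.
Implicit Types (p q : prime_idealr R).
Local Open Scope classical_set_scope.

Lemma supremum_le (A : set (\bar int)) (b : \bar int) :
  ((-1)%:E <= b)%E -> (forall x, A x -> x <= b)%E -> (supremum (-1)%:E A <= b)%E.
Proof.
move=> b1 Ab; rewrite /supremum; case: ifPn => [//|nA].
by have [_] := xgetPex (-1)%:E (supremums_ereal_int A); apply; apply: Ab.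
Qed.

Lemma le_supremum (A : set (\bar int)) x : A x -> (x <= supremum (-1)%:E A)%E.
Proof.
move=> Ax; rewrite /supremum; case: ifPn => [/eqP A0|nA]; first by move: Ax; rewrite A0.
by have [+ _] := xgetPex (-1)%:E (supremums_ereal_int A); apply.
Qed.

(** With [pull_prime], the correspondence between the primes of [R/p] and those of [R] containing
    [p]. Membership is tested on a representative; the choice is immaterial as [q] contains [p]. *)
Lemma lift_prime p q : (forall x, x \in p -> x \in q) ->
  exists q' : prime_idealr {ideal_quot p},
    forall x : R, \pi_{ideal_quot p} x \in q' <-> x \in q.
Proof.
move=> pq; pose P (z : {ideal_quot p}) := repr z \in q.
have PE x : P (\pi_{ideal_quot p} x) <-> x \in q.
  rewrite /P; have : repr (\pi_{ideal_quot p} x) - x \in q.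
    by apply: pq; rewrite Quotient.idealrBE reprK.
  move=> rx; split=> H; last by rewrite -[repr _](subrK x) rpredD.
  by rewrite -[x](subKr (repr (\pi_{ideal_quot p} x))) rpredB.
have [|q' q'E] := @prime_exists {ideal_quot p} P; last first.
  by exists q' => x; rewrite q'E.
have sur (z : {ideal_quot p}) : exists x, z = \pi_{ideal_quot p} x.
  by exists (repr z); rewrite reprK.
split.
- by rewrite -(rmorph0 \pi_{ideal_quot p}); apply/PE; rewrite rpred0.
- by rewrite -(rmorph1 \pi_{ideal_quot p}) => /PE; rewrite idealr1.
- move=> a u v; have [x ->] := sur a; have [y ->] := sur u; have [z ->] := sur v.
  move=> /PE yq /PE zq; rewrite -rmorphM -rmorphD; apply/PE.
  by rewrite rpredD // idealMr.
move=> u v; have [x ->] := sur u; have [y ->] := sur v.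
by rewrite -rmorphM => /PE; rewrite prime_idealrM => /orP[] H; [left|right]; apply/PE.
Qed.

Lemma pull_prime p (q' : prime_idealr {ideal_quot p}) :
  exists q, (forall x, x \in p -> x \in q) /\
    forall x : R, x \in q <-> \pi_{ideal_quot p} x \in q'.
Proof.
have [|q qE] := @prime_exists R (fun x => \pi_{ideal_quot p} x \in q').
  split.
  - by rewrite rmorph0 rpred0.
  - by rewrite rmorph1 idealr1.
  - by move=> a u v uq vq; rewrite rmorphD rmorphM rpredD // idealMr.
  by move=> u v; rewrite rmorphM prime_idealrM => /orP.
exists q; split=> // x xp; apply/qE.
have -> : \pi_{ideal_quot p} x = 0; last exact: rpred0.
by rewrite -(rmorph0 \pi_{ideal_quot p}); apply/eqP; rewrite -Quotient.idealrBE subr0.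
Qed.

Lemma krull_dim_le1 p : (krull_dim {ideal_quot p} <= 1%:E)%E <-> coht_lt 2 p.
Proof.
split=> [d1 q pq r qr|c2].
  have pr x : x \in p -> x \in r by move=> /(pq.1)/(qr.1).
  have [p' p'E] := lift_prime (fun x (xp : x \in p) => xp).
  have [q' q'E] := lift_prime pq.1; have [r' r'E] := lift_prime pr.
  have lt (u v : prime_idealr R) (u' v' : prime_idealr {ideal_quot p}) :
      (forall x : R, \pi_{ideal_quot p} x \in u' <-> x \in u) ->
      (forall x : R, \pi_{ideal_quot p} x \in v' <-> x \in v) ->
      prime_lt u v -> prime_lt u' v'.
    move=> uE vE [uv [x xv xu]]; split=> [z|].
      by rewrite -[z]reprK => /uE/uv/vE.
    exists (\pi_{ideal_quot p} x); first exact/vE.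
    by apply/negP => /uE; apply/negP.
  have pq' := lt _ _ _ _ p'E q'E pq; have qr' := lt _ _ _ _ q'E r'E qr.
  have pr' : prime_lt p' r'.
    split=> [x /(pq'.1)/(qr'.1)//|]; have [x xq xp] := pq'.2.
    by exists x => //; apply: qr'.1.
  have ch : prime_chain {ideal_quot p} 2.
    exists (fun i : 'I_3 =>
      if i == 0%N :> nat then p' else if i == 1%N :> nat then q' else r').
    by move=> [[|[|[|i]]] Hi] [[|[|[|j]]] Hj].
  have := le_trans (@le_supremum _ 2%:Z%:E (ex_intro2 _ _ 2%N ch erefl)) d1.
  by rewrite lee_fin.
apply: supremum_le; first by rewrite lee_fin.
move=> _ [n [P Pch] ->]; rewrite lee_fin lez_nat leqNgt; apply/negP => n2.
pose i0 : 'I_n.+1 := ord0; pose i1 : 'I_n.+1 := inord 1; pose i2 : 'I_n.+1 := inord 2.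
have v1 : i1 = 1%N :> nat by rewrite inordK // ltnS (ltn_trans _ n2).
have v2 : i2 = 2%N :> nat by rewrite inordK.
have [q1 [pq1 q1E]] := pull_prime (P i1); have [q2 [pq2 q2E]] := pull_prime (P i2).
have [|le01 [x1 x1P x1N]] := Pch i0 i1; first by rewrite v1.
have [|le12 [x2 x2P x2N]] := Pch i1 i2; first by rewrite v1 v2.
have [q0 [pq0 q0E]] := pull_prime (P i0).
(* The first prime of the chain need not be zero; what matters is that an element outside it is
   outside [p], so that [q1] is strictly larger than [p]. *)
apply: (c2 q1 _ q2).
  split=> //; exists (repr x1); first by apply/q1E; rewrite reprK.
  by apply/negP => /pq0/q0E; rewrite reprK; apply/negP.
split=> [x /q1E/le12/q2E //|]; exists (repr x2); first by apply/q2E; rewrite reprK.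
by apply/negP => /q1E; rewrite reprK; apply/negP.
Qed.

Lemma mod_dim_le1 (T : lmodType R) :
  (mod_dim T <= 1%:E)%E <-> supp_in (coht_lt 2) T.
Proof.
split=> [d1 p pT|sT].
  by apply/krull_dim_le1/(le_trans _ d1)/le_supremum; exists p.
apply: supremum_le; first by rewrite lee_fin.
by move=> _ [p /sT/krull_dim_le1 ? ->].
Qed.

End Dimension.

(** * Finiteness of Ext *)

Section ExtFinGen.
Variable R : comNzRingType.
Hypothesis noethR : noetherian R.
Implicit Types N M A B C U V W K Q : lmodType R.

Lemma fin_gen_class : abelian_class (@fin_gen R).
Proof.
split=> [V|U V W i p ip|U V K f k fU fV ki _|U V Q f q _ fV qs _].
- exact: fg0.
- by case: ip => _ ps ex; apply: (fg_ext (i := i)) ps _ => v /ex.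
- exact: (fg_inj noethR ki).
- exact: (fg_surj qs).
Qed.

(** The differential continued by zero in degree 0, where [0.-1 = 0] makes it an endomorphism of
    [res N 0]; all degrees of [Ext] are then treated alike. *)
Definition ext_d N (i : nat) : {linear res N i -> res N i.-1} :=
  if i is j.+1 then res_d N j else \0.

Lemma ext_cohomology N M i : is_cohomology (ext_d N i) (ext_d N i.+1) M (Ext N M i).
Proof.
have coc U V (d : {linear V -> U}) (c : Hom U M) : precomp M d c = 0 <-> cocycle d c.
  split=> [c0 x|c0]; last by apply: hom_ext => x; exact: c0.
  exact: (congr1 (fun h : Hom V M => (h : {linear _ -> _}) x) c0).
case: i => [|i].
  have [cl [clL clS cl0]] := homologyP
    (\0 : {linear Hom (res N 0) M -> Hom (res N 0) M}) (precomp M (res_d N 0)).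
  exists cl; split=> [a c c' /coc cc /coc cc'|h|c /coc cc].
  - exact: clL.
  - by have [c /coc cc cE] := clS h; exists c.
  rewrite cl0 //; split=> [[u <-]|[h hE]]; first by exists \0.
  by exists 0; apply: hom_ext => x; rewrite hE /= linear0.
have [cl [clL clS cl0]] := homologyP (precomp M (res_d N i)) (precomp M (res_d N i.+1)).
exists cl; split=> [a c c' /coc cc /coc cc'|h|c /coc cc].
- exact: clL.
- by have [c /coc cc cE] := clS h; exists c.
rewrite cl0 //; split=> [[u <-]|[h hE]]; first by exists u.
by exists h; apply: hom_ext => x; rewrite hE.
Qed.

Lemma ext_dd N i x : ext_d N i (ext_d N i.+1 x) = 0.
Proof.
case: i x => [|i] x //; apply/(res_d_exact (N := N)); by exists x.
Qed.

Lemma res_projective N i : projective (res N i).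
Proof. exact: free_projective. Qed.

Section Sequence.
Variables (N A B C : lmodType R) (i : {linear A -> B}) (p : {linear B -> C}).
Hypothesis ip : ses i p.
Local Notation E M n := (fin_gen (Ext N M n)).

Lemma Ext_mid n : E A n -> E C n -> E B n.
Proof.
exact: (coh_mid noethR ip (@ext_dd N n) (ext_cohomology N A n)
  (ext_cohomology N B n) (ext_cohomology N C n) (@res_projective N _)).
Qed.

Lemma Ext_right n : E B n -> E A n.+1 -> E C n.
Proof.
exact: (coh_right noethR ip (@ext_dd N n.+1) (ext_cohomology N B n)
  (ext_cohomology N C n) (ext_cohomology N A n.+1) (@res_projective N _)).
Qed.

Lemma Ext_left n : E C n -> E B n.+1 -> E A n.+1.
Proof.
exact: (coh_left noethR ip (@ext_dd N n) (@ext_dd N n.+1)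
  (ext_cohomology N C n) (ext_cohomology N A n.+1) (ext_cohomology N B n.+1)
  (@res_projective N _)).
Qed.

Lemma Ext_inj : E B 0 -> E A 0.
Proof.
by apply: (coh_inj noethR ip (ext_cohomology N A 0) (ext_cohomology N B 0)).
Qed.

End Sequence.

(** Multiplication by [a] on the resolution lifts the zero map of [N], hence is null-homotopic. *)
Lemma Ext_annihilated N M (a : R) n (c : Hom (res N n) M) :
  (forall x : N, a *: x = 0) -> cocycle (ext_d N n.+1) c -> cobound (ext_d N n) (a *: c).
Proof.
move=> aN cc.
have mul U : exists mu : {linear U -> U}, forall m, mu m = a *: m by exact: mul_linear_exists.
pose phi k := sval (cid (mul (syz N k))).
have phiE k x : phi k x = a *: x := svalP (cid (mul (syz N k))) x.
pose f k := sval (cid (mul (res N k))).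
have fE k x : f k x = a *: x := svalP (cid (mul (res N k))) x.
have [||s [s0 sS]] := @homotopy_exists R _ _ _ _ _ (res_resolution N) _ _ _ _ _
  (res_resolution N) phi f.
- split=> k x.
    rewrite fE phiE; exact: (linearZZ (free_cover (syz N k))).
  rewrite fE phiE; exact: (linearZZ (submod_incl _)).
- by move=> x; rewrite phiE aN.
case: n c cc => [|n] c cc.
  exists \0 => x; rewrite -[LHS]/(a *: c x) -(linearZZ c) -fE s0.
  exact: cc.
exists (c \o s n) => x; rewrite -[LHS]/(a *: c x) -(linearZZ c) -fE sS linearD.
rewrite -[RHS]add0r; congr (_ + _); exact: cc.
Qed.

Lemma Ext_mul N M (a : R) (K Q : lmodType R) (k : {linear K -> M}) (q : {linear M -> Q}) :
  (forall x : N, a *: x = 0) ->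
  injective k -> (forall m, a *: m = 0 <-> exists x, k x = m) ->
  surj q -> (forall m, q m = 0 <-> exists m', a *: m' = m) ->
  (forall n, fin_gen (Ext N K n)) -> (forall n, fin_gen (Ext N Q n)) ->
  forall n, fin_gen (Ext N M n).
Proof.
move=> aN ki kE qs qE fK fQ [|n].
  apply: (coh_mul0 noethR ki kE (ext_cohomology N K 0) (ext_cohomology N M 0)) => //.
  by move=> c; apply: Ext_annihilated.
apply: (coh_mul noethR ki kE qs qE (@ext_dd N n) (@ext_dd N n.+1)
  (ext_cohomology N Q n) (ext_cohomology N K n.+1) (ext_cohomology N M n.+1)) => //.
- exact: res_projective.
- exact: res_projective.
- by move=> c; apply: Ext_annihilated.
Qed.

Lemma Ext_fin_gen N M n : fin_gen N -> fin_gen M -> fin_gen (Ext N M n).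
Proof. by move=> fN fM; apply: (class_Ext noethR fin_gen_class). Qed.

Lemma fg_quot M (W : submodClosed M) : fin_gen M -> fin_gen (quotmod W).
Proof. exact: (fg_surj (@quot_pi_surj _ _ W)). Qed.

Lemma fg_quot_regular (J : submodClosed R^o) : fin_gen (quotmod J).
Proof. exact/fg_quot/fg_regular. Qed.

(* [Ext^0(R/J, M)] is identified with [0 :_M J] by evaluation at the class of 1. *)
Lemma Ext0_killed (J : submodClosed R^o) M (K : submodClosed M) :
  (forall m, m \in K <-> forall x : R, (x : R^o) \in J -> x *: m = 0) ->
  fin_gen (Ext (quotmod J) M 0) -> fin_gen (submod K).
Proof.
move=> KE fE; set N := quotmod J.
have [cl clP] := ext_cohomology N M 0.
have [Y [y [yi yP yE]]] := cocycles_exist (ext_d N 1) (idfun : {linear M -> M}).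
have yc t : cocycle (ext_d N 1) (y t) by exact: yP.
have [al alE] := cl_map clP yc.
(* In degree 0 only the zero cochain is a coboundary. *)
have ali : injective al.
  apply/lin_injP => t; rewrite alE => /(cl_eq0_inv clP (yc t))[h hE].
  apply: yi; rewrite linear0; apply: hom_ext => x.
  by rewrite hE /= linear0.
have fY := fg_inj noethR ali fE.
(* A cocycle of degree 0 factors through [N], and [u] lies over the class of 1, so its value at [u]
   is the value of the induced map at 1. *)
pose u : res N 0 := free_gen R (quot_pi J 1 : N).
have uE : free_cover N u = quot_pi J 1 by exact: free_lift_gen.
have cover0 (x : res N 0) : free_cover N x = 0 <-> exists z, res_d N 0 z = x.
  split=> [/kernelP xk|[z <-]].
    have [z zE] := free_cover_surj (Submod xk : syz N 1).
    exists z; rewrite -[RHS]/(submod_incl _ (Submod xk)) -zE //.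
  exact/kernelP/submod_incl_in.
have inK t : (y t : {linear _ -> _}) u \in K.
  apply/KE => x xJ; rewrite -(linearZZ (y t)).
  have /cover0[z <-] : free_cover N (x *: u) = 0.
    rewrite (linearZZ (free_cover N)) uE -(linearZZ (quot_pi J)).
    by apply/quot_pi0; rewrite /GRing.scale /= mulr1.
  exact: yP.
have [ev0 ev0E] : exists ev : {linear Y -> M}, forall t, ev t = (y t : {linear _ -> _}) u.
  by apply: linear_exists => b t t'; rewrite linearP.
have [t|ev evE] := @lift_inj _ _ _ _ (submod_incl K) ev0 (@submod_incl_inj _ _ _).
  by apply/submod_inclP; rewrite ev0E.
apply: (fg_surj (f := ev)) fY => m.
have mK : submod_incl K m \in K by exact: submod_incl_in.
have lm : linear (fun r : R^o => (r : R) *: submod_incl K m).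
  by move=> b r r'; rewrite scalerDl -scalerA.
have [f fE'] := linear_exists lm.
(* Conversely, for [m] in [K] the map sending the class of [r] to [r *: m] is well defined, and it
   gives a cocycle with value [m] at [u]. *)
have [r /quot_pi0 rJ|f' f'E] := @lift_surj _ _ _ _ (quot_pi J) f (@quot_pi_surj _ _ _).
  by rewrite fE'; move/KE: mK; apply.
have [|t tE] := yE (f' \o free_cover N : {linear res N 0 -> M}).
  by move=> x; rewrite /= (proj2 (cover0 _)) ?linear0 //; exists x.
exists t; apply: submod_incl_inj; rewrite evE ev0E tE.
by rewrite -[LHS]/(f' (free_cover N u)) uE f'E fE' scale1r.
Qed.

End ExtFinGen.

(** * Cofinite modules *)

Section Cofinite.
Variable R : comNzRingType.
Hypothesis noethR : noetherian R.
Variable I : submodClosed R^o.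
Implicit Types M T U V W K Q X Y : lmodType R.

Local Notation fgE M n := (fin_gen (Ext (quotmod I) M n)).

Lemma quot_annihilated (a : R) : (a : R^o) \in I -> forall x : quotmod I, a *: x = 0.
Proof.
move=> aI x; have [r <-] := quot_pi_surj x.
apply: etrans (esym (linearZZ (quot_pi I) a r)) _; apply/quot_pi0.
by rewrite [_ *: _]mulrC; apply: (rpredZ (r : R)).
Qed.

Lemma ideal_torsion M : supp_in (V_of I) M ->
  forall a : R, (a : R^o) \in I -> forall m : M, exists k, a ^+ k *: m = 0.
Proof. by move=> sM a aI; apply: (supp_nilpotent noethR) => p /sM; apply. Qed.

Lemma ses_injective U V (i : {linear U -> V}) :
  injective i -> ses i (quot_pi (image_submod i)).
Proof.
move=> ii; split=> //; first exact: quot_pi_surj.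
by move=> v; rewrite quot_pi0 imageP.
Qed.

Lemma Ext0_inj U V (i : {linear U -> V}) : injective i -> fgE V 0 -> fgE U 0.
Proof. by move=> /ses_injective; exact: (Ext_inj noethR). Qed.

(** Only degree 0 occurs, where Ext is left exact. The bound [e <= 1], that is, the restriction to
    modules of dimension at most one, enters the criterion here. *)
Lemma Ext_low_inj e U V (i : {linear U -> V}) : (e <= 1)%N -> injective i ->
  (forall n, (n < e)%N -> fgE V n) -> forall n, (n < e)%N -> fgE U n.
Proof.
move=> e1 ii fV n ne; have n0 : n = 0%N by move: (leq_trans ne e1); case: (n).
by rewrite n0 in ne *; exact: Ext0_inj ii (fV _ ne).
Qed.

Lemma Ext_low_left e U V W (i : {linear U -> V}) (p : {linear V -> W}) : ses i p ->
  (forall n, (n < e)%N -> fgE W n) -> (forall n, (n < e.+1)%N -> fgE V n) ->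
  forall n, (n < e.+1)%N -> fgE U n.
Proof.
move=> ip fW fV [|n] ne; first by case: ip => ii _ _; exact: Ext0_inj ii (fV _ ne).
by apply: (Ext_left noethR ip); [apply: fW|apply: fV].
Qed.

Lemma Ext_low_right e U V W (i : {linear U -> V}) (p : {linear V -> W}) : ses i p ->
  (forall n, (n < e.+1)%N -> fgE U n) -> (forall n, (n < e)%N -> fgE V n) ->
  forall n, (n < e)%N -> fgE W n.
Proof.
move=> ip fU fV n ne; apply: (Ext_right noethR ip); first exact: fV.
exact: fU.
Qed.

(** The index is shifted: [criterion e] concerns modules of dimension less than [e], so
    [criterion 2] is the case of dimension at most one. *)
Definition criterion e := forall M, supp_in (V_of I) M -> supp_in (coht_lt e) M ->
  (forall n, (n < e)%N -> fgE M n) -> forall n, fgE M n.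

Lemma criterion0 : criterion 0.
Proof.
move=> M _ sM _ n; apply: (Ext_fin_gen noethR); first exact: fg_quot_regular.
by apply: fg0; apply: (supp_empty noethR).
Qed.

(** * The induction step of the cofiniteness criterion *)

Section Step.
Variable e : nat.
Hypotheses (e1 : (e <= 1)%N) (crit : criterion e).
Variable xs : seq R.
Hypotheses (xsI : forall x, x \in xs -> (x : R^o) \in I)
  (xsE : forall a, (a : R^o) \in I -> lc (xs : seq R^o) a).

(** The list [zs] contains the generators of [I] that may still act nontrivially on [M]; its length
    is the inner induction parameter. *)
Definition mostly_killed (zs : seq R) M :=
  [/\ supp_in (V_of I) M, supp_in (coht_lt e.+1) M &
      forall x, x \in xs -> x \in zs \/ forall m : M, x *: m = 0].

Lemma mostly_killed_inj zs U V (f : {linear U -> V}) : injective f ->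
  mostly_killed zs V -> mostly_killed zs U.
Proof.
move=> fi [sI sc kV]; split; try exact: supp_in_inj fi _.
move=> x /kV[?|xV]; [by left|right=> m]; apply: fi.
by rewrite linear0 (linearZZ f) xV.
Qed.

Lemma mostly_killed_surj zs U V (f : {linear U -> V}) : surj f ->
  mostly_killed zs U -> mostly_killed zs V.
Proof.
move=> fs [sI sc kU]; split; try exact: supp_in_surj fs _.
move=> x /kU[?|xU]; [by left|right=> m]; have [u <-] := fs m.
by rewrite -(linearZZ f) xU linear0.
Qed.

Lemma mostly_killed_cons z zs M : mostly_killed (z :: zs) M ->
  (forall m : M, z *: m = 0) -> mostly_killed zs M.
Proof.
move=> [sI sc kM] zM; split=> // x /kM[]; last by right.
by rewrite inE => /orP[/eqP->|]; [right|left].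
Qed.

Lemma killed_ideal M (m : M) :
  killed xs m <-> forall a : R, (a : R^o) \in I -> a *: m = 0.
Proof.
split=> [km a aI|H x /xsI/H//].
have lm : linear (fun r : R^o => (r : R) *: m).
  by move=> b r r'; rewrite scalerDl -scalerA.
have [f fE] := linear_exists lm; rewrite -fE; apply/kernelP.
apply: lc_in (xsE aI) => x xxs; apply/kernelP; rewrite fE; exact: km.
Qed.

Lemma killed_fg M : fgE M 0 -> fin_gen (submod (killed_submod xs M)).
Proof.
apply: (Ext0_killed noethR) => m; rewrite -killed_ideal.
exact: (mem_prop_submod (killed_closed xs M)).
Qed.

Lemma Ext_mostly_killed0 M : mostly_killed [::] M ->
  (forall n, (n < e.+1)%N -> fgE M n) -> forall n, fgE M n.
Proof.
move=> [_ _ kM] fM n; apply: (Ext_fin_gen noethR); first exact: fg_quot_regular.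
apply: (fg_surj (f := submod_incl (killed_submod xs M))); last exact/killed_fg/fM.
move=> m; apply/submod_inclP/(mem_prop_submod (killed_closed xs M)) => x /kM[//|].
exact.
Qed.

Section Descent.
Variables (z : R) (zs : seq R).
Hypothesis zI : (z : R^o) \in I.
Hypothesis IH : forall M, mostly_killed zs M ->
  (forall n, (n < e.+1)%N -> fgE M n) -> forall n, fgE M n.

(** Induction on [k] along the kernel and the image of multiplication by [z]: the kernel falls under
    [IH], and the quotient by it is killed by a smaller power. *)
Lemma Ext_power_killed k M :
  mostly_killed (z :: zs) M -> (forall m : M, z ^+ k *: m = 0) ->
  (forall n, (n < e.+1)%N -> fgE M n) -> forall n, fgE M n.
Proof.
elim: k M => [|k IHk] M kM zM fM.
  move=> n; apply: (Ext_fin_gen noethR); first exact: fg_quot_regular.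
  by apply: fg0 => m; rewrite -(zM m) expr0 scale1r.
have [mu muE] := mul_linear_exists M z.
have sB := ses_quot (kernel mu); have [Bi Qs _] := sB.
have [v /quot_pi0/kernelP//|h hE] := @lift_surj _ _ _ _ (quot_pi (kernel mu)) mu Qs.
have hi : injective h.
  apply/lin_injP => y; have [m <-] := Qs y; rewrite hE => mu0.
  exact/quot_pi0/kernelP.
(* Multiplication by [z] embeds the quotient in [M], so its degrees below [e] are finite; this gives
   the degrees up to [e] of the kernel. *)
have fB := Ext_low_left sB (Ext_low_inj e1 hi (fun n ne => fM n (ltnW ne))) fM.
have allB : forall n, fgE (submod (kernel mu)) n.
  apply: IH fB; apply: (@mostly_killed_cons z).
    exact: mostly_killed_inj Bi kM.
  move=> m; apply: Bi; apply: etrans (linearZZ (submod_incl (kernel mu)) z m) _.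
  by rewrite linear0 -muE; apply/kernelP/submod_incl_in.
have allQ : forall n, fgE (quotmod (kernel mu)) n.
  apply: IHk.
  - exact: mostly_killed_surj Qs kM.
  - move=> y; have [m <-] := Qs y.
    apply: etrans (esym (linearZZ (quot_pi (kernel mu)) _ _)) _.
    by apply/quot_pi0/kernelP; rewrite muE scalerA -exprS.
  - exact: (Ext_low_right sB (fun n _ => allB n) fM).
by move=> n; apply: (Ext_mid noethR sB).
Qed.

(* For [k] large, [M] and [w M + (0 :_M w)], [w = z^k], agree up to a module
   [T] of smaller dimension. *)
Lemma Ext_descent M : mostly_killed (z :: zs) M ->
  (forall n, (n < e.+1)%N -> fgE M n) -> forall n, fgE M n.
Proof.
move=> kM fM; have [sI sc _] := kM.
have /choice[pw pwE] k : exists mu : {linear M -> M}, forall m, mu m = z ^+ k *: m.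
  exact: mul_linear_exists.
(* The chain of the submodules [z^k M] becomes stationary away from the primes of [coht_lt e]. *)
have [||||k0 k0P] := @artinian_killed R (coht_lt e) noethR xs M _ _ _
    (fun k => image_submod (pw k)).
- by move=> x /xsI; apply: ideal_torsion.
- exact/killed_fg/fM.
- by move=> p /sc.
- move=> k y /imageP[m <-]; apply/imageP; exists (z *: m).
  by rewrite !pwE exprSr scalerA.
(* The exponent is positive so that [w] annihilates [R/I]. *)
pose w := z ^+ k0.+1; have [mu muE] := mul_linear_exists M w.
have wN (x : quotmod I) : w *: x = 0.
  by rewrite /w exprSr -scalerA (quot_annihilated zI) scaler0.
have [D' [D's D'E]] := corestrict mu.
pose B := submod (kernel mu); pose D := submod (image_submod mu).
have sBD : ses (submod_incl (kernel mu) : {linear B -> M}) D'.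
  split=> //; first exact: submod_incl_inj.
  move=> m; rewrite -submod_inclP kernelP -D'E; split=> [->|mu0]; first exact: linear0.
  by apply: submod_incl_inj; rewrite mu0 linear0.
have Di : injective (submod_incl (image_submod mu)) by exact: submod_incl_inj.
have Bi : injective (submod_incl (kernel mu)) by exact: submod_incl_inj.
(* [D = w M] embeds in [M], which controls its degrees below [e]; the sequence [B -> M -> D] then
   controls [B] up to degree [e]. *)
have fB := Ext_low_left sBD (Ext_low_inj e1 Di (fun n ne => fM n (ltnW ne))) fM.
have kB : mostly_killed (z :: zs) B by exact: mostly_killed_inj Bi kM.
have wB (b : B) : w *: b = 0.
  apply: Bi; apply: etrans (linearZZ (submod_incl (kernel mu)) w b) _.
  by rewrite linear0 -muE; apply/kernelP/submod_incl_in.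
have allB := Ext_power_killed kB wB fB.
have fD : forall n, (n < e.+1)%N -> fgE D n.
  exact: (Ext_low_right sBD (fun n _ => allB n) fM).
have sD := ses_quot (image_submod mu); pose MD := quotmod (image_submod mu).
have [_ qs _] := sD.
have fMD : forall n, (n < e)%N -> fgE MD n.
  exact: (Ext_low_right sD fD (fun n ne => fM n (ltnW ne))).
(* The kernel of [g] is the intersection of [B] and [w M], and its cokernel is
   [T = M / (w M + B)]. *)
pose g : {linear B -> MD} := quot_pi (image_submod mu) \o submod_incl (kernel mu).
have [g' [g's g'E]] := corestrict g.
have sC := ses_kernel g's.
have Ci : injective (submod_incl (image_submod g)) by exact: submod_incl_inj.
have fBD := Ext_low_left sC (Ext_low_inj e1 Ci fMD) (fun n _ => allB n).
have BDi : injective (submod_incl (kernel g')) by exact: submod_incl_inj.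
have allBD : forall n, fgE (submod (kernel g')) n.
  apply: Ext_power_killed fBD; first exact: mostly_killed_inj BDi kB.
  move=> b; apply: BDi; apply: etrans (linearZZ (submod_incl (kernel g')) w b) _.
  by rewrite linear0 wB.
have allC n : fgE (submod (image_submod g)) n.
  by apply: (Ext_right noethR sC).
have sT := ses_quot (image_submod g); pose T := quotmod (image_submod g).
have [_ ts _] := sT.
have allT : forall n, fgE T n.
  apply: crit.
  - exact: supp_in_surj ts (supp_in_surj qs sI).
  - move=> p /suppP[t tp]; apply: contrapT => Gp.
    have [y yt] := ts t; have [m my] := qs y.
    (* Since [w *: m] lies in [z^k0 M], some [r] outside [p] satisfies [r w m = w^2 m']. Then
       [r *: m - w *: m'] lies in [B], so [r] kills the class of [m] in [T]. *)
    have [||r /negP rp /imageP[m' m'E]] := k0P (k0.+1 + k0.+1)%N _ (w *: m) _ p Gp.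
    + by rewrite addSn ltnW // ltnS leq_addr.
    + by apply/imageP; exists (z *: m); rewrite pwE scalerA -exprSr.
    apply/rp/tp; rewrite -yt -my.
    rewrite -(linearZZ (quot_pi (image_submod g))) -(linearZZ (quot_pi (image_submod mu))).
    apply/quot_pi0/imageP.
    have bB : r *: m - w *: m' \in kernel mu.
      apply/kernelP; rewrite muE scalerBr scalerA [w * r]mulrC -scalerA -m'E pwE.
      by rewrite exprD scalerA subrr.
    exists (Submod bB).
    apply: etrans (linearB (quot_pi (image_submod mu)) (r *: m) (w *: m')) _.
    have e0 : quot_pi (image_submod mu) (w *: m') = 0.
      by apply/quot_pi0/imageP; exists m'; rewrite muE.
    exact: etrans (congr1 (fun x => _ - x) e0) (subr0 _).
  - exact: (Ext_low_right sT (fun n _ => allC n) fMD).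
have allMD n : fgE MD n by apply: (Ext_mid noethR sT).
apply: (Ext_mul noethR (k := submod_incl (kernel mu)) (q := quot_pi (image_submod mu))
  wN) => //.
- by move=> m; rewrite -muE -kernelP submod_inclP.
- move=> m; rewrite quot_pi0 imageP.
  by split=> -[m' m'E]; exists m'; rewrite -m'E muE.
Qed.

End Descent.

Lemma Ext_mostly_killed zs M : (forall x, x \in zs -> (x : R^o) \in I) ->
  mostly_killed zs M -> (forall n, (n < e.+1)%N -> fgE M n) -> forall n, fgE M n.
Proof.
elim: zs M => [|z zs IH] M zsI; first exact: Ext_mostly_killed0.
apply: Ext_descent; first by apply: zsI; rewrite inE eqxx.
by move=> X; apply: IH => x xzs; apply: zsI; rewrite inE xzs orbT.
Qed.

End Step.

Lemma criterionS e : (e <= 1)%N -> criterion e -> criterion e.+1.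
Proof.
move=> e1 crit M sI sc fM.
have [xs [xsI xsE]] := proj1 (fg_submodP I) (noethR I).
by apply: (Ext_mostly_killed e1 crit xsI xsE xsI) fM; split=> // x; left.
Qed.

Lemma criterion2 : criterion 2.
Proof. exact/criterionS/criterionS/criterion0. Qed.

(** * Stability properties of finite-by-dimension-one modules *)

Definition FD_supp M := exists W : submodClosed M,
  fin_gen (submod W) /\ supp_in (coht_lt 2) (quotmod W).

Lemma FD_suppP M : FD_le1 M <-> FD_supp M.
Proof. by split=> -[W [fW dW]]; exists W; split=> //; apply/mod_dim_le1. Qed.

Lemma FD_supp_inj U V (f : {linear U -> V}) : injective f -> FD_supp V -> FD_supp U.
Proof.
move=> fi [W [fW sW]]; exists (preim_submod f W); split.
  have [u|h hE] := @lift_inj _ _ _ _ (submod_incl W)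
      (f \o submod_incl (preim_submod f W)) (@submod_incl_inj _ _ _).
    by apply/submod_inclP; have /preimP := submod_incl_in u.
  apply: (fg_inj noethR (f := h)) fW => u v /(congr1 (submod_incl W)).
  by rewrite !hE => /fi/submod_incl_inj.
have [v /quot_pi0/preimP H|h hE] := @lift_surj _ _ _ _
    (quot_pi (preim_submod f W)) (quot_pi W \o f) (@quot_pi_surj _ _ _).
  exact/quot_pi0.
apply: (supp_in_inj (f := h)) sW; apply/lin_injP => y.
have [u <-] := quot_pi_surj y; rewrite hE => /quot_pi0 H.
exact/quot_pi0/preimP.
Qed.

Lemma FD_supp_surj V Q (q : {linear V -> Q}) : surj q -> FD_supp V -> FD_supp Q.
Proof.
move=> qs [W [fW sW]]; pose W' := image_submod (q \o submod_incl W).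
exists W'; split.
  by have [h [hs _]] := corestrict (q \o submod_incl W); apply: fg_surj hs fW.
have [v /quot_pi0/submod_inclP[x xv]|h hE] := @lift_surj _ _ _ _
    (quot_pi W) (quot_pi W' \o q) (@quot_pi_surj _ _ _).
  by apply/quot_pi0/imageP; exists x; rewrite /= -xv.
apply: (supp_in_surj (f := h)) sW => y.
have [x <-] := quot_pi_surj y; have [v <-] := qs x.
by exists (quot_pi W v); rewrite hE.
Qed.

(** Generators of [B] are lifted to [V] through a finite free module. The submodule [S] that they
    generate together with [A] is finitely generated, and [V / S] is an extension of a quotient of
    [X / B] by a quotient of [U / A]. *)
Lemma FD_supp_ext U V X (i : {linear U -> V}) (p : {linear V -> X}) :
  ses i p -> FD_supp U -> FD_supp X -> FD_supp V.
Proof.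
move=> ip [A [fA sA]] [B [fB sB]]; have [ii ps ex] := ip.
have [[n c] /= cs] := fg_cover_exists (exist _ (submod B : lmodType R) fB).
have [c' c'E] := free_projective (submod_incl B \o c) ps.
pose F := free_mod R 'I_n.
have [h hE] : exists h : {linear (submod A * F)%type -> V},
    forall x, h x = i (submod_incl A x.1) + c' x.2.
  apply: linear_exists => a x y.
  rewrite -[LHS]/(i (submod_incl A (a *: x.1 + y.1)) + c' (a *: x.2 + y.2)).
  by rewrite (linearP (submod_incl A)) (linearP i) (linearP c') scalerDr addrACA.
exists (image_submod h); split.
  have [h' [h's _]] := corestrict h; apply: fg_surj h's _.
  have [in1 in1E] : exists f : {linear submod A -> (submod A * F)%type},
      forall x, f x = (x, 0).
    apply: linear_exists => a x y.
    by rewrite -[RHS]/(a *: x + y, a *: (0 : F) + 0) scaler0 addr0.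
  have [pr2 pr2E] : exists f : {linear (submod A * F)%type -> F},
      forall x, f x = x.2 by exact: linear_exists.
  apply: (fg_ext (i := in1) (p := pr2)) => //; last exact: free_mod_fg.
  - by move=> y; exists (0, y); rewrite pr2E.
  - by move=> [x y]; rewrite pr2E /= => ->; exists x; rewrite in1E.
pose S := image_submod h; pose g : {linear U -> quotmod S} := quot_pi S \o i.
have [g' [g's g'E]] := corestrict g.
apply: (supp_in_ext (ses_quot (image_submod g))).
  have [u /quot_pi0/submod_inclP[x xu]|k kE] := @lift_surj _ _ _ _
      (quot_pi A) g' (@quot_pi_surj _ _ _).
    apply: submod_incl_inj; rewrite g'E linear0; apply/quot_pi0/imageP.
    by exists (x, 0); rewrite hE linear0 addr0 /= -xu.
  apply: (supp_in_surj (f := k)) sA => y; have [u <-] := g's y.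
  by exists (quot_pi A u); rewrite kE.
have [v /ex[u uv]|k kE] := @lift_surj _ _ _ _ p
    (quot_pi (image_submod g) \o quot_pi S) ps.
  by apply/quot_pi0/imageP; exists u; rewrite -uv.
have [x /quot_pi0/submod_inclP[y yx]|l lE] := @lift_surj _ _ _ _ (quot_pi B) k
    (@quot_pi_surj _ _ _).
  have [z zy] := cs y; rewrite -yx -zy -[submod_incl _ _]c'E kE.
  rewrite -[LHS]/(quot_pi _ (quot_pi S (c' z))).
  have -> : quot_pi S (c' z) = 0; last exact: linear0.
  by apply/quot_pi0/imageP; exists (0, z); rewrite hE !linear0 add0r.
apply: (supp_in_surj (f := l)) sB => y.
have [t <-] := quot_pi_surj y; have [v <-] := quot_pi_surj t.
by exists (quot_pi B (p v)); rewrite lE kE.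
Qed.

(** Dividing by the finitely generated [W], all of whose Ext modules are finitely generated, reduces
    the claim to [criterion2] for the quotient. *)
Lemma FD_supp_criterion M : supp_in (V_of I) M -> FD_supp M ->
  (forall n, (n < 2)%N -> fgE M n) -> forall n, fgE M n.
Proof.
move=> sI [W [fW sW]] fM n; have sq := ses_quot W; have [_ qs _] := sq.
have allW k : fgE (submod W) k.
  by apply: (Ext_fin_gen noethR) => //; exact: fg_quot_regular.
apply: (Ext_mid noethR sq); first exact: allW.
apply: criterion2; [exact: supp_in_surj qs sI|exact: sW|].
exact: (Ext_low_right sq (fun n _ => allW n) fM).
Qed.

Lemma cofinite_FD_class : abelian_class (fun M => cofinite I M /\ FD_le1 M).
Proof.
suff : abelian_class (fun M => [/\ supp_in (V_of I) M, FD_supp M & forall n, fgE M n]).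
  set C := fun M => [/\ _, _ & _]; set C' := fun M => _ /\ _.
  suff -> : C = C' by [].
  apply/funext => M; apply/propext; rewrite /C /C' FD_suppP; split=> [[]//|[[]]//].
(* The image of [f] embeds in [V], so its Ext in degree 0 is finitely generated. This bounds degrees
   0 and 1 of the kernel, to which the criterion applies; the image then follows in all degrees. The
   cokernel case below uses the image. *)
have imC U V K (f : {linear U -> V}) (k : {linear K -> U}) :
    injective k -> (forall u, f u = 0 <-> exists x, k x = u) ->
    [/\ supp_in (V_of I) U, FD_supp U & forall n, fgE U n] ->
    [/\ supp_in (V_of I) V, FD_supp V & forall n, fgE V n] ->
    (forall n, fgE K n) /\ (forall n, fgE (submod (image_submod f)) n).
  move=> ki kE [sU dU fU] [sV dV fV]; have [f' [f's f'E]] := corestrict f.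
  have fI0 : fgE (submod (image_submod f)) 0.
    exact: Ext0_inj (@submod_incl_inj _ _ (image_submod f)) (fV 0%N).
  have sf : ses k f'.
    split=> // u; rewrite -kE -f'E.
    split=> [->|f0]; first exact: linear0.
    by apply: submod_incl_inj; rewrite f0 linear0.
  have fK : forall n, fgE K n.
    apply: FD_supp_criterion; [exact: supp_in_inj ki sU|exact: FD_supp_inj ki dU|].
    by apply: (Ext_low_left sf) => [[]|n _].
  by split=> // n; apply: (Ext_right noethR sf).
split.
- move=> V V0; split.
  + by move=> p /suppP[t tp] x _; apply: tp; rewrite (V0 (x *: t)).
  + have c0 : True /\ forall (a : R) (u v : V), True -> True -> True by [].
    exists (@prop_submod R V (fun=> True) c0); split.
      by apply: fg0 => v; apply: submod_incl_inj; rewrite [LHS]V0 [RHS]V0.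
    move=> p /suppP[t tp]; have [v vt] := quot_pi_surj t.
    have : (1 : R) \in p by apply: tp; rewrite scale1r -vt (V0 v) linear0.
    by rewrite idealr1.
  + move=> n; apply: (Ext_fin_gen noethR); first exact: fg_quot_regular.
    exact: fg0.
- move=> U V W i p ip [sU dU fU] [sW dW fW]; split.
  + exact: supp_in_ext ip sU sW.
  + exact: FD_supp_ext ip dU dW.
  + by move=> n; apply: (Ext_mid noethR ip).
- move=> U V K f k CU CV ki kE; have [fK _] := imC _ _ _ f k ki kE CU CV.
  by case: CU => sU dU _; split=> //; [exact: supp_in_inj ki sU|exact: FD_supp_inj ki dU].
move=> U V Q f q CU CV qs qE.
have kE u : f u = 0 <-> exists x, submod_incl (kernel f) x = u.
  by rewrite -submod_inclP kernelP.
have [_ fI] := imC _ _ _ f _ (@submod_incl_inj _ _ (kernel f)) kE CU CV.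
case: CV => sV dV fV; split; [exact: supp_in_surj qs sV|exact: FD_supp_surj qs dV|].
have sq : ses (submod_incl (image_submod f)) q.
  split=> //; first exact: submod_incl_inj.
  by move=> v; rewrite qE -submod_inclP imageP.
by move=> n; apply: (Ext_right noethR sq).
Qed.

End Cofinite.

Theorem corollary3p8 (R : comNzRingType) (noethR : noetherian R)
    (I : submodClosed R^o) (M : lmodType R)
    (M_FD : FD_le1 M) (M_cof : cofinite I M)
    (N : lmodType R) (N_fg : fin_gen N) (i : nat) :
  (cofinite I (Ext N M i) /\ FD_le1 (Ext N M i)) /\
  (cofinite I (Tor N M i) /\ FD_le1 (Tor N M i)).
Proof.
have abC := cofinite_FD_class noethR I.
split; first exact: (class_Ext noethR abC (conj M_cof M_FD) N_fg).
exact: (class_Tor noethR abC (conj M_cof M_FD) N_fg).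
Qed.
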